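(* Let $i,r,n\geq 0$ be fixed integers. Then: 1. There exists a finite list of pointed cographs $\{(G_j,K_j)\}_{j=1}^{l}$ with $|K_j|=r$, such that for any pointed cograph $(G,K)$ with $|K|=r$, the homology group $H_i(\Sigma(G,K,n);\mathbb{Z})$ is generated by the homology classes of the groups $H_i(\Sigma(G_j,K_j,n);\mathbb{Z})$ pushed forward along full embeddings $(G_j,K_j)\hookrightarrow(G,K)$. 2. There exists an integer $d_{i,r,n}\geq 1$ such that for any pointed cograph $(G,K)$ with $|K|=r$, the exponent of the torsion subgroup of $H_i(\Sigma(G,K,n);\mathbb{Z})$ divides $d_{i,r,n}$. 3. For any field $k$, the function $$m\mapsto \dim_k\big(H_i(\Sigma(K_m,[r],n);k)\big)$$ agrees with a polynomial in $m$ for all $m\gg 0$.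
   Context: All graphs are finite and simple. The class of cographs is defined inductively: the single vertex is a cograph, and if $G_1,G_2$ are cographs then so are the disjoint union $G_1\sqcup G_2$ and the edge-complements $\overline{G_1},\overline{G_2}$; equivalently, cographs are the graphs with no induced path $P_4$ on four vertices. A pointed cograph is a pair $(G,K)$ of a cograph $G$ and a set $K$ of vertices of $G$. A full embedding $(G,K)\hookrightarrow(G',K')$ is an injection $\phi$ of vertex sets such that two vertices are adjacent in $G$ if and only if their images are adjacent in $G'$, and such that $\phi(K)=K'$. Regarding $G$ as a $1$-dimensional simplicial complex, the $n$-pointed anchored configuration space $\Sigma(G,K,n)$ of $G$ relative to $K$ is the subcomplex of the cubical complex $G^n$ consisting of all points $(x_1,\ldots,x_n)\in G^n$ such that every element of $K$ appears at least once among the $x_i$. A full embedding $(G,K)\hookrightarrow(G',K')$ induces a map $\Sigma(G,K,n)\to\Sigma(G',K',n)$. $K_m$ denotes the complete graph on vertex set $\{1,\dots,m\}$ and $[r]=\{1,\dots,r\}$, with $m\ge r$. *)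

(* Defs.v *)
From HB Require Import structures.
From mathcomp Require Import all_boot all_order all_algebra.
From mathcomp Require Import boolp classical_sets.
Set Implicit Arguments.
Unset Strict Implicit.
Unset Printing Implicit Defensive.
Import Order.TTheory GRing.Theory Num.Theory.
Local Open Scope ring_scope.
Local Open Scope quotient_scope.

Record sgraph := SGraph {
  vertex :> finType;
  adj : rel vertex;
  adj_sym : symmetric adj;
  adj_irr : irreflexive adj }.
Arguments adj {s} _ _ : rename.

Lemma complete_sym (V : finType) : symmetric (fun x y : V => x != y).
Proof. by move=> x y; rewrite eq_sym. Qed.

Lemma complete_irr (V : finType) : irreflexive (fun x y : V => x != y).
Proof. by move=> x; rewrite eqxx. Qed.

Definition complete_graph (V : finType) : sgraph :=
  SGraph (@complete_sym V) (@complete_irr V).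

Section GraphOps.
Variables G H : sgraph.

Definition union_adj (x y : G + H) : bool :=
  match x, y with
  | inl a, inl b => adj a b
  | inr a, inr b => adj a b
  | _, _ => false
  end.

Lemma union_sym : symmetric union_adj.
Proof. by case=> [a|a] [b|b] //=; rewrite adj_sym. Qed.

Lemma union_irr : irreflexive union_adj.
Proof. by case=> a /=; rewrite adj_irr. Qed.

Definition disjoint_union : sgraph := SGraph union_sym union_irr.

Definition compl_adj (x y : G) : bool := (x != y) && ~~ adj x y.

Lemma compl_sym : symmetric compl_adj.
Proof. by move=> x y; rewrite /compl_adj eq_sym adj_sym. Qed.

Lemma compl_irr : irreflexive compl_adj.
Proof. by move=> x; rewrite /compl_adj eqxx. Qed.

Definition edge_complement : sgraph := SGraph compl_sym compl_irr.

Definition graph_iso : Prop :=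
  exists2 f : G -> H, bijective f & forall x y, adj (f x) (f y) = adj x y.

End GraphOps.

Inductive cograph : sgraph -> Prop :=
| cograph_point : cograph (complete_graph unit)
| cograph_union G H : cograph G -> cograph H -> cograph (disjoint_union G H)
| cograph_compl G : cograph G -> cograph (edge_complement G)
| cograph_iso G H : graph_iso G H -> cograph G -> cograph H.

Record pgraph := PGraph { pg_graph :> sgraph; pts : {set pg_graph} }.

Record full_embedding (P Q : pgraph) := FullEmbedding {
  emb :> P -> Q;
  emb_inj : injective emb;
  emb_adj : forall x y, adj (emb x) (emb y) = adj x y;
  emb_pts : emb @: pts P = pts Q }.

(* A vertex [inl v], or an oriented edge [inr (u, v)] going from u to v. *)
Definition osimplex (G : sgraph) : finType :=
  (G + {e : G * G | adj e.1 e.2})%type.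

Section OSimplex.
Variable G : sgraph.

Lemma rev_arc_subproof (e : {e : G * G | adj e.1 e.2}) :
  adj ((val e).2, (val e).1).1 ((val e).2, (val e).1).2.
Proof. by rewrite /= adj_sym (valP e). Qed.

Definition rev_simplex (s : osimplex G) : osimplex G :=
  match s with
  | inl v => inl v
  | inr e => inr (exist _ ((val e).2, (val e).1) (rev_arc_subproof e))
  end.

Definition is_edge (s : osimplex G) : bool := if s is inr _ then true else false.

Definition target (s : osimplex G) : osimplex G :=
  if s is inr e then inl (val e).2 else s.

Lemma rev_simplexK : involutive rev_simplex.
Proof. by case=> [v|[[u v] h]] //=; congr inr; apply: val_inj. Qed.

Lemma is_edge_rev s : is_edge (rev_simplex s) = is_edge s.
Proof. by case: s. Qed.

Lemma is_edge_target s : is_edge (target s) = false.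
Proof. by case: s. Qed.

End OSimplex.

(* A cube of G^n, with a chosen orientation of each of its edge factors; the
   factors themselves are ordered by their position in the product. *)
Definition cube (G : sgraph) (n : nat) : finType := {ffun 'I_n -> osimplex G}.

Section Cube.
Variables (G : sgraph) (n : nat).
Implicit Types (s : cube G n) (j : 'I_n).

Definition cube_dim s : nat := #|[set j | is_edge (s j)]|.

Definition reverse j s : cube G n :=
  [ffun l => if l == j then rev_simplex (s l) else s l].

Definition face j s : cube G n :=
  [ffun l => if l == j then target (s l) else s l].

Definition koszul j s : nat := #|[set l : 'I_n | (l < j)%N && is_edge (s l)]|.

Lemma reverseK j : involutive (reverse j).
Proof.
move=> s; apply/ffunP=> l; rewrite !ffunE.
by case: eqP => // _; rewrite rev_simplexK.
Qed.

Lemma is_edge_reverse j s l : is_edge (reverse j s l) = is_edge (s l).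
Proof. by rewrite ffunE; case: eqP; rewrite ?is_edge_rev. Qed.

Lemma koszul_reverse j l s : koszul j (reverse l s) = koszul j s.
Proof. by apply: eq_card => k; rewrite !inE is_edge_reverse. Qed.

Lemma cube_dim_reverse l s : cube_dim (reverse l s) = cube_dim s.
Proof. by apply: eq_card => k; rewrite !inE is_edge_reverse. Qed.

Lemma cube_dim_face j s : is_edge (s j) -> cube_dim s = (cube_dim (face j s)).+1.
Proof.
move=> sj; rewrite /cube_dim (cardsD1 j) inE sj add1n; congr _.+1.
apply: eq_card => l; rewrite !inE ffunE.
by case: eqP => //= _; rewrite is_edge_target.
Qed.

Lemma face_reverseE j l s : l != j -> face j (reverse l s) = reverse l (face j s).
Proof.
move=> lj; apply/ffunP=> k; rewrite !ffunE.
by have [->|//] := eqVneq k l; rewrite (negPf lj).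
Qed.

Lemma face_face j l s : face j (face l s) = face l (face j s).
Proof.
apply/ffunP=> k; rewrite !ffunE.
by have [->|] := eqVneq k j; case: eqVneq.
Qed.

Lemma face_edge j l s : is_edge (face j s l) = (l != j) && is_edge (s l).
Proof. by rewrite ffunE; case: eqVneq => //; rewrite is_edge_target. Qed.

End Cube.

(* All points of a product of closed simplices of G have every v in K among
   their coordinates iff every v in K is one of the factors: on an edge factor
   the coordinate can be chosen to be an interior point. *)
Definition in_anchored (P : pgraph) (n : nat) (s : cube P n) : bool :=
  [forall v in pts P, [exists j, s j == inl v]].

Section Homology.
Variables (R : comNzRingType) (P : pgraph) (n : nat).

(* Cubical p-chains of the anchored configuration space: functions on the
   oriented p-cubes that change sign when an edge factor is reversed. *)
Definition chain (p : nat) : {pred {ffun cube P n -> R^o}} := fun c =>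
  [forall s, ((c s != 0) ==> in_anchored s && (cube_dim s == p)) &&
     [forall j, is_edge (s j) ==> (c (reverse j s) == - c s)]].

(* The boundary of an oriented edge is its target minus its source; the source
   terms are those of the reversed edge. *)
Definition boundary (c : {ffun cube P n -> R^o}) : {ffun cube P n -> R^o} :=
  [ffun t => \sum_(j < n) \sum_(s : cube P n | is_edge (s j) && (face j s == t))
               (-1) ^+ koszul j s * c s].

Definition is_cycle (p : nat) : {pred {ffun cube P n -> R^o}} := fun c =>
  (c \in chain p) && (boundary c == 0).

Lemma chainP p (c : {ffun cube P n -> R^o}) : reflect
  [/\ forall s : cube P n, c s != 0 -> in_anchored s,
      forall s : cube P n, c s != 0 -> cube_dim s = p &
      forall j (s : cube P n), is_edge (s j) -> c (reverse j s) = - c s] (c \in chain p).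
Proof.
apply: (iffP forallP) => [h|[h1 h2 h3] s].
  split=> [s|s|j s sj]; have /andP[/implyP h1 /forallP h2] := h s.
  - by case/h1/andP.
  - by case/h1/andP=> _ /eqP.
  - exact/eqP/(implyP (h2 j)).
apply/andP; split; first by apply/implyP=> cs; rewrite h1 //= h2.
by apply/forallP=> j; apply/implyP=> /h3 ->.
Qed.

Lemma chain_submod p : submod_closed (chain p).
Proof.
split=> [|a x y /chainP[x1 x2 x3] /chainP[y1 y2 y3]].
  by apply/chainP; split=> [s|s|j s]; rewrite !ffunE ?eqxx ?oppr0.
have nz s : (a *: x + y) s != 0 -> (x s != 0) || (y s != 0).
  rewrite !ffunE; apply: contraR; rewrite negb_or !negbK => /andP[/eqP-> /eqP->].
  by rewrite scaler0 addr0.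
apply/chainP; split=> [s /nz /orP[/x1|/y1]|s /nz /orP[/x2|/y2]|j s sj] //.
by rewrite !ffunE x3 // y3 // scalerN opprD.
Qed.

Lemma boundary_linear : linear boundary.
Proof.
move=> a x y; apply/ffunP=> t; rewrite !ffunE scaler_sumr -big_split /=.
apply: eq_bigr => j _; rewrite scaler_sumr -big_split /=; apply: eq_bigr => s _.
by rewrite !ffunE mulrDr /GRing.scale /= mulrCA.
Qed.

HB.instance Definition _ := GRing.isLinear.Build R _ _ _ boundary boundary_linear.

Lemma is_cycle_submod p : submod_closed (is_cycle p).
Proof.
have [c0 cD] := chain_submod p.
split=> [|a x y /andP[xc /eqP x0] /andP[yc /eqP y0]]; rewrite /in_mem /= /is_cycle.
  by rewrite c0 linear0 eqxx.
by rewrite cD //= boundary_linear x0 y0 scaler0 addr0 eqxx.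
Qed.

HB.instance Definition _ p := GRing.isSubmodClosed.Build R _ (is_cycle p)
  (is_cycle_submod p).

Record cycle (p : nat) := Cycle {
  cycle_val :> {ffun cube P n -> R^o};
  cycleP : cycle_val \in is_cycle p }.

HB.instance Definition _ p := [isSub for @cycle_val p].
HB.instance Definition _ p := [Choice of cycle p by <:].
HB.instance Definition _ p := [SubChoice_isSubLmodule of cycle p by <:].

Definition is_boundary (p : nat) : {pred cycle p} := fun z =>
  `[< exists2 b, b \in chain p.+1 & cycle_val z = boundary b >].

Lemma is_boundary_submod p : submod_closed (is_boundary (p := p)).
Proof.
have [c0 cD] := chain_submod p.+1.
split=> [|a x y /asboolP[b bc xb] /asboolP[d dc yd]]; apply/asboolP.
  by exists 0 => //; rewrite linear0.
by exists (a *: b + d); [apply: cD | rewrite boundary_linear -xb -yd].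
Qed.

HB.instance Definition _ p := GRing.isSubmodClosed.Build R _ (@is_boundary p)
  (is_boundary_submod p).

Lemma boundary_chain p b : b \in chain p.+1 -> boundary b \in chain p.
Proof.
move=> /chainP[b1 b2 b3].
have nz (t : cube P n) : boundary b t != 0 ->
    exists j (s : cube P n), [/\ is_edge (s j), face j s = t & b s != 0].
  apply: contraNP => h; rewrite ffunE big1 // => j _; rewrite big1 // => s.
  case/andP=> sj /eqP st; have [->|bs] := eqVneq (b s) 0; first by rewrite mulr0.
  by case: h; exists j, s.
apply/chainP; split=> [t /nz[j [s [sj <- bs]]]|t /nz[j [s [sj <- bs]]]|l t tl].
- apply/forall_inP=> v /(forall_inP (b1 _ bs)) /existsP[k /eqP sk].
  by apply/existsP; exists k; rewrite ffunE sk; case: ifP.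
- by apply/eqP; rewrite -eqSS -(cube_dim_face sj) b2.
rewrite !ffunE -sumrN; apply: eq_bigr => j _; rewrite -sumrN.
have [lj|lj] := eqVneq l j.
  rewrite !big_pred0 // => s; apply/negP => /andP[sj /eqP /ffunP/(_ l) h].
    by move: tl; rewrite -h lj ffunE eqxx is_edge_target.
  by move: tl; rewrite -(is_edge_reverse l) -h lj ffunE eqxx is_edge_target.
rewrite (reindex_inj (inv_inj (reverseK l))); apply: eq_big => [s|s].
  by rewrite is_edge_reverse face_reverseE // (inj_eq (inv_inj (reverseK l))).
rewrite is_edge_reverse face_reverseE // (inj_eq (inv_inj (reverseK l))).
case/andP=> sj /eqP st.
have sl : is_edge (s l) by move: tl; rewrite -st face_edge lj.
by rewrite koszul_reverse b3 // mulrN.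
Qed.

Lemma boundaryK b : boundary (boundary b) = 0.
Proof.
apply/ffunP=> t; rewrite !ffunE.
pose F (j l : 'I_n) : R := \sum_(s : cube P n | [&& is_edge (s j), is_edge (s l),
  l != j & face j (face l s) == t]) (-1) ^+ (koszul j (face l s) + koszul l s) * b s.
transitivity (\sum_j \sum_l F j l).
  apply: eq_bigr => j _.
  transitivity (\sum_(s : cube P n | is_edge (s j) && (face j s == t))
     \sum_l \sum_(u : cube P n | is_edge (u l) && (face l u == s))
       (-1) ^+ (koszul j s + koszul l u) * b u).
    apply: eq_bigr => s _; rewrite ffunE mulr_sumr; apply: eq_bigr => l _.
    by rewrite mulr_sumr; apply: eq_bigr => u _; rewrite exprD mulrA.
  rewrite exchange_big; apply: eq_bigr => l _ /=.
  rewrite (exchange_big_dep (fun u : cube P n => is_edge (u l))) /=; last first.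
    by move=> s u _ /andP[].
  rewrite /F (bigID (fun u : cube P n =>
    [&& is_edge (u j), l != j & face j (face l u) == t])) /=.
  rewrite [X in _ + X]big1 ?addr0; last first.
    move=> u /andP[ul h]; rewrite big_pred0 // => s; apply/negP.
    case/andP=> /andP[sj st] /andP[_ /eqP us]; case/negP: h.
    by move: sj st; rewrite -us face_edge => /andP[jl ->] ->; rewrite eq_sym jl.
  apply: eq_big => [u|u /andP[ul /and3P[uj lj fu]]].
    by rewrite andbCA.
  rewrite (big_pred1 (face l u)) // => s; rewrite ul /= [RHS]eq_sym.
  by case: (face l u =P s) => [<-|]; rewrite ?andbF // fu face_edge uj eq_sym lj.
have Fjj j : F j j = 0 by rewrite /F big_pred0 // => s; rewrite eqxx !andbF.
have FC (j l : 'I_n) : (j < l)%N -> F l j = - F j l.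
  move=> jl.
  rewrite /F -sumrN; apply: eq_big => [s|s].
    by rewrite face_face andbCA eq_sym.
  case/and4P=> sl sj _ _.
  suff -> : (koszul l s = (koszul l (face j s)).+1)%N.
    suff -> : koszul j (face l s) = koszul j s.
      by rewrite addnS exprS mulN1r mulNr opprK addnC.
    apply: eq_card => k; rewrite !inE face_edge.
    by have [->|//] := eqVneq k l; rewrite /= andbF ltnNge ltnW.
  rewrite /koszul (cardsD1 j) inE jl sj add1n; congr _.+1.
  by apply: eq_card => k; rewrite !inE face_edge andbCA.
transitivity (\sum_(j < n) (\sum_(l : 'I_n | (j < l)%N) F j l
                    + \sum_(l : 'I_n | (l < j)%N) F j l)).
  apply: eq_bigr => j _; rewrite (bigID (fun l : 'I_n => (j < l)%N)) /=.
  congr (_ + _); rewrite (bigD1 j) ?ltnn //= Fjj add0r.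
  by apply: eq_bigl => l; rewrite -leqNgt ltn_neqAle andbC.
rewrite big_split /=.
rewrite [X in _ + X](exchange_big_dep xpredT) //= -big_split big1 // => j _ /=.
rewrite -big_split /= big1 // => l jl; rewrite (FC _ _ jl).
exact: addrN.
Qed.

Definition homology (p : nat) : Type := Quotient.quot (@is_boundary p).

HB.instance Definition _ p := GRing.Zmodule.on (homology p).

Definition hclass (p : nat) (z : cycle p) : homology p :=
  \pi_(Quotient.quot (@is_boundary p)) z.

Definition hrepr (p : nat) (x : homology p) : cycle p :=
  repr (x : Quotient.quot (@is_boundary p)).

Lemma hreprK p : cancel (@hrepr p) (@hclass p).
Proof. exact: reprK. Qed.

Lemma hclass_is_zmod_morphism p : zmod_morphism (@hclass p).
Proof. exact: pi_is_zmod_morphism. Qed.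

HB.instance Definition _ p := GRing.isZmodMorphism.Build _ _ (@hclass p)
  (@hclass_is_zmod_morphism p).

Lemma hclass_eq p (x y : cycle p) :
  (hclass x == hclass y) = (x - y \in @is_boundary p).
Proof. by rewrite (Quotient.idealrBE (@is_boundary p)). Qed.

Definition hscale p (a : R) (x : homology p) : homology p :=
  hclass (a *: hrepr x).

Lemma hscaleE p a (z : cycle p) : hscale a (hclass z) = hclass (a *: z).
Proof.
apply/eqP; rewrite hclass_eq -scalerBr; apply: rpredZ.
by rewrite -hclass_eq hreprK.
Qed.

Lemma hscaleA p a b (x : homology p) : hscale a (hscale b x) = hscale (a * b) x.
Proof. by rewrite -[x]hreprK !hscaleE scalerA. Qed.

Lemma hscale1 p : left_id 1 (@hscale p).
Proof. by move=> x; rewrite -[x]hreprK !hscaleE scale1r. Qed.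

Lemma hscaleDr p : right_distributive (@hscale p) +%R.
Proof.
move=> a x y; rewrite -[x]hreprK -[y]hreprK -raddfD !hscaleE scalerDr.
exact: raddfD.
Qed.

Lemma hscaleDl p (x : homology p) : {morph (@hscale p)^~ x : a b / a + b}.
Proof.
by move=> a b; rewrite -[x]hreprK !hscaleE scalerDl; apply: raddfD.
Qed.

HB.instance Definition _ p := GRing.Zmodule_isLmodule.Build R (homology p)
  (@hscaleA p) (@hscale1 p) (@hscaleDr p) (@hscaleDl p).

End Homology.

Section Pushforward.
Variables (R : comNzRingType) (P Q : pgraph) (f : full_embedding P Q) (n : nat).

Lemma push_arc_subproof (e : {e : P * P | adj e.1 e.2}) :
  adj (f (val e).1, f (val e).2).1 (f (val e).1, f (val e).2).2.
Proof. by rewrite /= emb_adj (valP e). Qed.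

Definition push_simplex (s : osimplex P) : osimplex Q :=
  match s with
  | inl v => inl (f v)
  | inr e => inr (exist _ (f (val e).1, f (val e).2) (push_arc_subproof e))
  end.

Definition push_cube (s : cube P n) : cube Q n := [ffun j => push_simplex (s j)].

Definition push_chain (c : {ffun cube P n -> R^o}) : {ffun cube Q n -> R^o} :=
  [ffun t => \sum_(s | push_cube s == t) c s].

Lemma is_edge_push s : is_edge (push_simplex s) = is_edge s.
Proof. by case: s. Qed.

Lemma push_reverse j s : push_cube (reverse j s) = reverse j (push_cube s).
Proof.
apply/ffunP=> l; rewrite !ffunE; case: eqP => // _.
by case: (s l) => //= e; congr inr; apply: val_inj.
Qed.

Lemma push_face j s : push_cube (face j s) = face j (push_cube s).
Proof.
by apply/ffunP=> l; rewrite !ffunE; case: eqP => // _; case: (s l).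
Qed.

Lemma koszul_push j s : koszul j (push_cube s) = koszul j s.
Proof. by apply: eq_card => l; rewrite !inE ffunE is_edge_push. Qed.

Lemma cube_dim_push s : cube_dim (push_cube s) = cube_dim s.
Proof. by apply: eq_card => l; rewrite !inE ffunE is_edge_push. Qed.

Lemma in_anchored_push s : in_anchored s -> in_anchored (push_cube s).
Proof.
move=> /forall_inP h; apply/forall_inP=> w; rewrite -(emb_pts f).
case/imsetP=> v /h /existsP[j /eqP sj] ->.
by apply/existsP; exists j; rewrite ffunE sj.
Qed.

Lemma push_chain_chain p c : c \in chain p -> push_chain c \in chain p.
Proof.
move=> /chainP[c1 c2 c3].
have nz t : push_chain c t != 0 -> exists2 s, push_cube s = t & c s != 0.
  apply: contraNP => h; rewrite ffunE big1 // => s /eqP st.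
  by have [//|cs] := eqVneq (c s) 0; case: h; exists s.
apply/chainP; split=> [t /nz[s <- cs]|t /nz[s <- cs]|j t tj].
- exact/in_anchored_push/c1.
- by rewrite cube_dim_push c2.
rewrite !ffunE (reindex_inj (inv_inj (reverseK j))) -sumrN.
apply: eq_big => [s|s].
  by rewrite push_reverse (inj_eq (inv_inj (reverseK j))).
rewrite push_reverse (inj_eq (inv_inj (reverseK j))) => /eqP st.
by apply: c3; move: tj; rewrite -st ffunE is_edge_push.
Qed.

Lemma boundary_push c : boundary (push_chain c) = push_chain (boundary c).
Proof.
apply/ffunP=> t; rewrite !ffunE.
under [RHS]eq_bigr do rewrite ffunE.
rewrite exchange_big; apply: eq_bigr => j _ /=.
transitivity (\sum_(s : cube P n | is_edge (s j) && (push_cube (face j s) == t))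
   (-1) ^+ koszul j s * c s).
  under eq_bigr do rewrite ffunE mulr_sumr.
  rewrite (exchange_big_dep (fun s : cube P n =>
    is_edge (s j) && (push_cube (face j s) == t))) /=; last first.
    move=> u s /andP[uj ut] /eqP su; move: uj ut.
    by rewrite -su ffunE is_edge_push push_face => -> ->.
  apply: eq_bigr => s /andP[sj st]; rewrite (big_pred1 (push_cube s)) /=.
    by rewrite koszul_push.
  move=> u /=; rewrite [push_cube s == u]eq_sym.
  case: (u =P push_cube s) => [->|]; rewrite ?andbF //.
  by rewrite ffunE is_edge_push sj -push_face st.
rewrite (exchange_big_dep (fun s : cube P n =>
    is_edge (s j) && (push_cube (face j s) == t))) /=; last first.
  by move=> u s ut /andP[-> /eqP ->].
apply: eq_bigr => s /andP[sj st]; rewrite (big_pred1 (face j s)) // => u /=.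
rewrite sj /= [face j s == u]eq_sym.
by case: (u =P face j s) => [->|]; rewrite ?andbF // st.
Qed.

Lemma push_cycle_subproof p (z : cycle R P n p) :
  push_chain z \in is_cycle p.
Proof.
case/andP: (cycleP z) => zc /eqP z0.
rewrite /in_mem /= /is_cycle push_chain_chain //= boundary_push z0.
by apply/eqP/ffunP=> t; rewrite !ffunE big1 // => s _; rewrite ffunE.
Qed.

Definition push_cycle p (z : cycle R P n p) : cycle R Q n p :=
  Cycle (push_cycle_subproof z).

Definition homology_push p (x : homology R P n p) : homology R Q n p :=
  hclass (push_cycle (hrepr x)).

Lemma homology_pushE p (z : cycle R P n p) :
  homology_push (hclass z) = hclass (push_cycle z).
Proof.
apply/eqP; rewrite hclass_eq.
have : hrepr (hclass z) - z \in @is_boundary R P n p.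
  by rewrite -hclass_eq hreprK.
case/asboolP=> b bc zb; apply/asboolP; exists (push_chain b).
  exact: push_chain_chain.
rewrite boundary_push -zb; apply/ffunP=> t; rewrite !ffunE -sumrB.
by apply: eq_bigr => s _; rewrite !ffunE.
Qed.

End Pushforward.

Section AbelianGroups.
Variable A : zmodType.
Local Open Scope classical_set_scope.

Definition is_subgroup (B : set A) : Prop :=
  B 0 /\ forall x y, B x -> B y -> B (x - y).

Definition subgroup_generated (S : set A) : set A := smallest is_subgroup S.

Definition torsion : set A := [set x | exists2 N, (0 < N)%N & x *+ N = 0].

(* The exponent is 0 when no positive integer annihilates S. *)
Definition exponent (S : set A) : nat :=
  let annihilates N := `[< (0 < N)%N /\ forall x, S x -> x *+ N = 0 >] in
  if pselect (exists N, annihilates N) is left h then ex_minn h else 0%N.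

End AbelianGroups.

Definition has_dimension (k : fieldType) (V : lmodType k) (d : nat) : Prop :=
  inhabited (Vector.axiom d V).

(* The vertices 1, ..., m are represented by the elements 0, ..., m - 1 of 'I_m. *)
Definition complete_pgraph (m r : nat) : pgraph :=
  @PGraph (complete_graph 'I_m) [set x : 'I_m | (x < r)%N].

(* Main.v *)
(** The chains of the anchored space form a subcomplex of the n-fold tensor power
    of the simplicial chains of [G], and a chain map of [G] sending each vertex
    of [K] to a multiple of itself acts on it factor by factor.  A cograph has no
    induced path on four vertices, so each vertex [v] is joined to a base point
    of its component by a path [h v] with at most two edges.  Sending [v] to
    itself if it lies in [K] and to its base point otherwise is homotopic to the
    identity relative to [K], and on chains of [G] this map is the sum of one
    piece for each component, supported on the paths [h v] with [v] in [K], and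
    one for each edge (u, v), sending it to the closed walk through [h u],
    (u, v) and [h v].  Expanding the tensor power writes every homology class as a
    sum of images under operators that factor through induced subgraphs with at
    most 3|K| + 6n + 1 vertices; this bounds both the generators and the torsion.
    On complete graphs, with the star at one vertex as system of paths, the
    operators are orthogonal idempotents, and the rank of each depends only on
    the set of factors where it uses a loop piece.  Since there are (m-1)(m-2)/2
    loop pieces for [K_m], the dimension is a polynomial in m. *)

Require Import Defs.
From mathcomp Require Import all_boot all_order all_algebra.
From mathcomp Require Import boolp classical_sets ring.
From HB Require Import structures.
Set Implicit Arguments.
Unset Strict Implicit.
Unset Printing Implicit Defensive.
Import GRing.Theory.
Local Open Scope ring_scope.

(** * Operators acting factor by factor *)

Section Tensor.
Variables (R : comNzRingType) (n : nat).

(** Each [F j] is a matrix with rows indexed by simplices of [G] and columns by simplices of [H],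
    and [tens F] is their tensor product, without Koszul signs. Matrices compose from left to right,
    as in [mcomp]. *)
Definition tens (G H : sgraph) (F : 'I_n -> osimplex G -> osimplex H -> R)
    (c : {ffun cube G n -> R^o}) : {ffun cube H n -> R^o} :=
  [ffun t : cube H n => \sum_(s : cube G n) (\prod_j F j (s j) (t j)) * c s].

Lemma tens_linear G H (F : 'I_n -> osimplex G -> osimplex H -> R) : linear (tens F).
Proof.
move=> a x y; apply/ffunP=> t; rewrite !ffunE scaler_sumr -big_split /=.
by apply: eq_bigr => s _; rewrite !ffunE mulrDr /GRing.scale /= mulrCA.
Qed.

HB.instance Definition _ G H (F : 'I_n -> osimplex G -> osimplex H -> R) :=
  GRing.isLinear.Build R _ _ _ (tens F) (tens_linear F).

Lemma eq_tens G H (F F' : 'I_n -> osimplex G -> osimplex H -> R) c :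
  (forall j s t, F j s t = F' j s t) -> tens F c = tens F' c.
Proof.
move=> e; apply/ffunP=> t; rewrite !ffunE; apply: eq_bigr => s _.
by congr (_ * _); apply: eq_bigr => j _; rewrite e.
Qed.

Definition mcomp (G H L : sgraph) (A : osimplex G -> osimplex H -> R)
    (B : osimplex H -> osimplex L -> R) (s : osimplex G) (t : osimplex L) : R :=
  \sum_x A s x * B x t.

Lemma tens_comp G H L (F : 'I_n -> osimplex G -> osimplex H -> R)
    (F' : 'I_n -> osimplex H -> osimplex L -> R) c :
  tens F' (tens F c) = tens (fun j => mcomp (F j) (F' j)) c.
Proof.
apply/ffunP=> t; rewrite !ffunE.
under eq_bigr do rewrite ffunE mulr_sumr.
rewrite exchange_big; apply: eq_bigr => s _ /=.
rewrite /mcomp bigA_distr_bigA mulr_suml; apply: eq_bigr => u _.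
by rewrite big_split /= mulrCA mulrA.
Qed.

Lemma tens_sum G H (I : finType) (F : I -> osimplex G -> osimplex H -> R) c :
  tens (fun _ s t => \sum_a F a s t) c =
  \sum_(w : {ffun 'I_n -> I}) tens (fun j => F (w j)) c.
Proof.
apply/ffunP=> t; rewrite ffunE sum_ffunE.
under [RHS]eq_bigr do rewrite ffunE.
rewrite exchange_big; apply: eq_bigr => s _ /=.
by rewrite bigA_distr_bigA mulr_suml.
Qed.

Lemma tens_at G H (j : 'I_n) (F F1 F2 : 'I_n -> osimplex G -> osimplex H -> R) a c :
    (forall l s t, l != j -> F l s t = F1 l s t) ->
    (forall l s t, l != j -> F l s t = F2 l s t) ->
    (forall s t, F j s t = a * F1 j s t + F2 j s t) ->
  tens F c = a *: tens F1 c + tens F2 c.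
Proof.
move=> e1 e2 ej; apply/ffunP=> t; rewrite !ffunE scaler_sumr -big_split /=.
apply: eq_bigr => s _; rewrite !(bigD1 (P := xpredT) j) //= ej.
have <- : \prod_(l | l != j) F l (s l) (t l) = \prod_(l | l != j) F1 l (s l) (t l).
  by apply: eq_bigr => l lj; rewrite e1.
have <- : \prod_(l | l != j) F l (s l) (t l) = \prod_(l | l != j) F2 l (s l) (t l).
  by apply: eq_bigr => l lj; rewrite e2.
by rewrite /GRing.scale /= !mulrDl !mulrA.
Qed.

Lemma tens_opp G H (j : 'I_n) (F F1 : 'I_n -> osimplex G -> osimplex H -> R) c :
    (forall l s t, l != j -> F l s t = F1 l s t) ->
    (forall s t, F j s t = - F1 j s t) ->
  tens F c = - tens F1 c.
Proof.
move=> e1 ej; apply/ffunP=> t; rewrite !ffunE -sumrN.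
apply: eq_bigr => s _; rewrite !(bigD1 (P := xpredT) j) //= ej !mulNr.
by congr (- (_ * _ * _)); apply: eq_bigr => l lj; rewrite e1.
Qed.

Definition delta (G : sgraph) (s t : osimplex G) : R := (s == t)%:R.
(** Only the target of an oriented edge appears here. On alternating functions the reversed edge
    supplies the source with a minus sign. *)
Definition bd (G : sgraph) (s t : osimplex G) : R := (is_edge s && (target s == t))%:R.

Lemma mcomp_deltar (G H : sgraph) (A : osimplex G -> osimplex H -> R) s t :
  mcomp A (@delta H) s t = A s t.
Proof.
rewrite /mcomp (bigD1 t) //= /delta eqxx mulr1 big1 ?addr0 // => x.
by move=> /negPf->; rewrite mulr0.
Qed.

Lemma mcomp_deltal (G H : sgraph) (A : osimplex G -> osimplex H -> R) s t :
  mcomp (@delta G) A s t = A s t.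
Proof.
rewrite /mcomp (bigD1 s) //= /delta eqxx mul1r big1 ?addr0 // => x.
by rewrite eq_sym => /negPf->; rewrite mul0r.
Qed.

(* [M] acting on the factor [j], with the Koszul sign of an odd operator moving
   past the edges among the preceding factors. *)
Definition koszul_at (G : sgraph) (j : 'I_n) (M : osimplex G -> osimplex G -> R)
    (l : 'I_n) (s t : osimplex G) : R :=
  (-1) ^+ ((l < j)%N && is_edge s) * (if l == j then M s t else delta s t).

Lemma koszul_at_eq G j (M : osimplex G -> osimplex G -> R) s t : koszul_at j M j s t = M s t.
Proof. by rewrite /koszul_at ltnn eqxx mul1r. Qed.

Lemma koszul_at_neq G j (M : osimplex G -> osimplex G -> R) l s t : l != j ->
  koszul_at j M l s t = (-1) ^+ ((l < j)%N && is_edge s) * delta s t.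
Proof. by rewrite /koszul_at => /negPf->. Qed.

Lemma mcomp_koszul_atl (G H : sgraph) j M l (A : osimplex G -> osimplex H -> R) s t :
  l != j -> mcomp (koszul_at j M l) A s t = (-1) ^+ ((l < j)%N && is_edge s) * A s t.
Proof.
move=> lj; rewrite /mcomp (bigD1 s) //= koszul_at_neq // /delta eqxx mulr1 big1 ?addr0 // => x.
by rewrite koszul_at_neq // /delta eq_sym => /negPf->; rewrite mulr0 mul0r.
Qed.

Lemma mcomp_koszul_atr (G H : sgraph) j M l (A : osimplex G -> osimplex H -> R) s t :
  l != j -> mcomp A (koszul_at j M l) s t = (-1) ^+ ((l < j)%N && is_edge t) * A s t.
Proof.
move=> lj; rewrite mulrC /mcomp (bigD1 t) //= koszul_at_neq // /delta eqxx mulr1.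
rewrite big1 ?addr0 // => x.
by rewrite koszul_at_neq // /delta => /negPf->; rewrite !mulr0.
Qed.

Lemma prod_bool (I : finType) (b : I -> bool) :
  \prod_i (b i)%:R = [forall i, b i]%:R :> R.
Proof.
have [/forallP h|] := boolP [forall i, b i].
  by rewrite big1 // => i _; rewrite h.
rewrite negb_forall => /existsP[i bi].
by rewrite (bigD1 i) //= (negPf bi) mul0r.
Qed.

(** The product over the factors splits into signs, which multiply to the Koszul sign of [j], and
    indicators, which together say that [t] is the face of [s] at [j]. *)
Lemma boundary_tens (P : pgraph) (c : {ffun cube P n -> R^o}) :
  boundary c = \sum_j tens (koszul_at j (@bd P)) c.
Proof.
apply/ffunP=> t; rewrite ffunE sum_ffunE; apply: eq_bigr => j _.
rewrite ffunE big_mkcond /=; apply: eq_bigr => s _.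
have -> : \prod_l koszul_at j (@bd P) l (s l) (t l) =
    (-1) ^+ koszul j s * (is_edge (s j) && (face j s == t))%:R.
  rewrite big_split /=; congr (_ * _).
    rewrite /koszul -sum1_card -prodrXr [RHS]big_mkcond /=.
    apply: eq_bigr => l _.
    by rewrite inE; case: (_ && _).
  transitivity (\prod_l (if l == j then is_edge (s l) && (target (s l) == t l)
      else s l == t l)%:R : R).
    by apply: eq_bigr => l _; case: eqP.
  rewrite prod_bool; congr (_ : bool)%:R.
  apply/forallP/andP => [h|[sj /eqP<-] l].
    split; first by have := h j; rewrite eqxx => /andP[].
    apply/eqP/ffunP=> l; rewrite ffunE; have := h l.
    by case: eqP => [_ /andP[_ /eqP]|_ /eqP].
  by rewrite ffunE; case: (l =P j) => [->|]; rewrite ?sj /=.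
by case: ifP; rewrite ?mulr1 // mulr0 mul0r.
Qed.

End Tensor.

(** * Linear forms on alternating functions *)

Section Alternating.
Variables (R : comNzRingType) (G : sgraph).

(** Selects one of the two orientations of each edge; vertices count as positive. *)
Definition positive (s : osimplex G) : bool :=
  if s is inr e then (enum_rank (val e).1 < enum_rank (val e).2)%N else true.

Lemma positive_rev s : is_edge s -> positive (rev_simplex s) = ~~ positive s.
Proof.
case: s => // -[[u v] /= uv] _; rewrite -leqNgt ltn_neqAle andb_idl // => _.
apply: contraTneq uv => e; have /enum_rank_inj-> : enum_rank v = enum_rank u by apply: val_inj.
by rewrite adj_irr.
Qed.

(* The two linear forms take the same values on alternating functions. *)
Definition alt_eq (a b : osimplex G -> R) : Prop :=
  forall s, if is_edge s then a s - a (rev_simplex s) = b s - b (rev_simplex s)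
            else a s = b s.

Definition alternating n (c : {ffun cube G n -> R^o}) : Prop :=
  forall j (s : cube G n), is_edge (s j) -> c (reverse j s) = - c s.

Lemma alt_eq_ext (a a' b b' : osimplex G -> R) :
  a =1 a' -> b =1 b' -> alt_eq a' b' -> alt_eq a b.
Proof. by move=> aE bE h s; rewrite !aE !bE; apply: h. Qed.

Lemma alt_eq_sym (a b : osimplex G -> R) : alt_eq a b -> alt_eq b a.
Proof. by move=> h s; have := h s; case: ifP. Qed.

Lemma eq_alt_eq (a b : osimplex G -> R) : a =1 b -> alt_eq a b.
Proof. by move=> e s; rewrite !e; case: ifP. Qed.

(** The predicate [p] picks one element of each pair [x], [f x], so the terms cancel in pairs. No
    division by two occurs, hence the ring may have characteristic two. *)
Lemma sum_anti_invariant (I : finType) (q p : pred I) (f : I -> I) (y : I -> R) :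
    involutive f -> (forall x, q (f x) = q x) ->
    (forall x, q x -> p (f x) = ~~ p x) -> (forall x, q x -> y (f x) = - y x) ->
  \sum_(x | q x) y x = 0.
Proof.
move=> fK qf pf yf; rewrite (bigID p) /= [X in _ + X](reindex_inj (inv_inj fK)) /=.
rewrite [X in _ + X](eq_bigl (fun x => q x && p x)) => [|x]; last first.
  by rewrite qf; case qx: (q x) => //=; rewrite pf // negbK.
by rewrite -big_split big1 // => x /andP[qx _]; rewrite /= yf // subrr.
Qed.

(** By [alt_eq] the difference of the two forms at [j] is unchanged when an edge is reversed, while
    [c] changes sign, so these terms cancel in pairs. On vertices the two forms agree. *)
Lemma sum_alt_eq1 n (c : {ffun cube G n -> R^o}) j (w w' : 'I_n -> osimplex G -> R) :
    alternating c -> (forall l s, l != j -> w l s = w' l s) -> alt_eq (w j) (w' j) ->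
  \sum_(s : cube G n) (\prod_l w l (s l)) * c s =
  \sum_(s : cube G n) (\prod_l w' l (s l)) * c s.
Proof.
move=> alt_c ww' wj; apply/eqP; rewrite -subr_eq0 -sumrB; apply/eqP.
rewrite (bigID (fun s : cube G n => is_edge (s j))) /=.
have prodE (s : cube G n) : (\prod_l w l (s l)) * c s - (\prod_l w' l (s l)) * c s =
    (w j (s j) - w' j (s j)) * (\prod_(l | l != j) w l (s l)) * c s.
  rewrite !(bigD1 (P := xpredT) j) //=.
  have <- : \prod_(l | l != j) w l (s l) = \prod_(l | l != j) w' l (s l).
    by apply: eq_bigr => l lj; rewrite ww'.
  by rewrite !mulrBl.
rewrite [X in _ + X]big1 ?addr0 => [|s sj]; last first.
  by rewrite prodE; have := wj (s j); rewrite (negPf sj) => ->; rewrite subrr !mul0r.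
apply: (@sum_anti_invariant _ (fun s : cube G n => is_edge (s j))
  (fun s => positive (s j)) (@reverse G n j)).
- exact: reverseK.
- by move=> s; rewrite is_edge_reverse.
- by move=> s sj; rewrite ffunE eqxx positive_rev.
move=> s sj; rewrite !prodE alt_c // mulrN ffunE eqxx.
congr (- (_ * _ * _)); last first.
  by apply: eq_bigr => l /negPf lj; rewrite ffunE lj.
have := wj (s j); rewrite sj => /eqP; rewrite subr_eq => /eqP ->; ring.
Qed.

Lemma sum_alt_eq n (c : {ffun cube G n -> R^o}) (w w' : 'I_n -> osimplex G -> R) :
    alternating c -> (forall l, alt_eq (w l) (w' l)) ->
  \sum_(s : cube G n) (\prod_l w l (s l)) * c s =
  \sum_(s : cube G n) (\prod_l w' l (s l)) * c s.
Proof.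
move=> alt_c ww'.
(* [W k] has the new form on the first [k] factors, so that factors are replaced one at a time. *)
pose W k (l : 'I_n) := if (l < k)%N then w' l else w l.
suff WE k : (k <= n)%N -> \sum_(s : cube G n) (\prod_l w l (s l)) * c s =
    \sum_(s : cube G n) (\prod_l W k l (s l)) * c s.
  rewrite (WE n) //; apply: eq_bigr => s _; congr (_ * _).
  by apply: eq_bigr => l _; rewrite /W ltn_ord.
elim: k => [_|k IHk kn]; first by apply: eq_bigr => s _; congr (_ * _); apply: eq_bigr.
rewrite IHk 1?ltnW //; apply: (@sum_alt_eq1 _ _ (Ordinal kn)) => // [l s|].
  by rewrite -val_eqE /= /W ltnS => lk; rewrite [(l <= k)%N]leq_eqVlt (negPf lk).
by rewrite /W /= ltnn ltnSn.
Qed.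

End Alternating.

Section TensAlternating.
Variables (R : comNzRingType) (n : nat) (G H : sgraph).
Implicit Type F : 'I_n -> osimplex G -> osimplex H -> R.

Lemma tens_alt_eq F F' c : alternating c ->
  (forall j t, alt_eq (F j ^~ t) (F' j ^~ t)) -> tens F c = tens F' c.
Proof.
move=> alt_c FF'; apply/ffunP=> t; rewrite !ffunE.
by apply: (@sum_alt_eq _ _ _ _ (fun l s => F l s (t l)) (fun l s => F' l s (t l))).
Qed.

Lemma alternating_tens F c : alternating c ->
    (forall j t, is_edge t -> alt_eq (F j ^~ (rev_simplex t)) (fun s => - F j s t)) ->
  alternating (tens F c).
Proof.
move=> alt_c altF j t tj; rewrite !ffunE -sumrN.
have -> : \sum_(s : cube G n) (\prod_l F l (s l) (reverse j t l)) * c s =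
  \sum_(s : cube G n) (\prod_l (if l == j then - F l (s l) (t l) else F l (s l) (t l))) * c s.
  apply: (@sum_alt_eq _ _ _ _ (fun l s => F l s (reverse j t l))
    (fun l s => if l == j then - F l s (t l) else F l s (t l))) => // l.
  rewrite ffunE; case: eqP => [->|_]; first exact: altF.
  by move=> s; case: ifP.
apply: eq_bigr => s _; rewrite (bigD1 j) //= eqxx [in RHS](bigD1 j) //= !mulNr.
by congr (- (_ * _ * _)); apply: eq_bigr => l /negPf->.
Qed.

Lemma tens_neq0 F c t : tens F c t != 0 ->
  exists2 s : cube G n, c s != 0 & forall j, F j (s j) (t j) != 0.
Proof.
rewrite ffunE; apply: contraNP => h; rewrite big1 // => s _.
have [->|cs] := eqVneq (c s) 0; first by rewrite mulr0.
have /existsP[j /eqP Fj] : [exists j, F j (s j) (t j) == 0].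
  apply: contra_notT h; rewrite negb_exists => /forallP h.
  by exists s.
by rewrite (bigD1 j) //= Fj !mul0r.
Qed.

End TensAlternating.

Lemma chain_alternating (R : comNzRingType) (P : pgraph) n p (c : {ffun cube P n -> R^o}) :
  c \in chain p -> alternating c.
Proof. by move=> /chainP[_ _ h] j s; apply: h. Qed.

(** * Koszul signs *)

Section Koszul.
Variables (R : comNzRingType) (n : nat).

Definition odd_mx (G : sgraph) (M : osimplex G -> osimplex G -> R) :=
  forall s t, M s t != 0 -> is_edge s = ~~ is_edge t.

Definition even_mx (G H : sgraph) (M : osimplex G -> osimplex H -> R) :=
  forall s t, M s t != 0 -> is_edge s = is_edge t.

Lemma odd_bd G : odd_mx (@bd R G).
Proof.
move=> s t; rewrite /bd; case: (boolP (_ && _)); last by rewrite eqxx.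
by case/andP=> -> /eqP <- _; rewrite is_edge_target.
Qed.

Lemma even_delta G : even_mx (@delta R G).
Proof. by move=> s t; rewrite /delta; case: (s =P t) => [->//|_]; rewrite eqxx. Qed.

(** If [j] precedes [l], applying the odd [M] flips the parity of factor [j], which changes the
    Koszul sign of [N] by -1. At all other factors the order does not matter. *)
Lemma tens_koszul_atC (G : sgraph) (M N : osimplex G -> osimplex G -> R)
    (j l : 'I_n) (c : {ffun cube G n -> R^o}) :
    odd_mx M -> odd_mx N -> j != l ->
  tens (koszul_at l N) (tens (koszul_at j M) c) =
  - tens (koszul_at j M) (tens (koszul_at l N) c).
Proof.
wlog jl : j l M N / (j < l)%N => [hw oM oN|].
  case: (ltngtP j l) => [jl|lj|/val_inj->]; last by rewrite eqxx.
    by move=> ne; apply: hw.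
  by rewrite eq_sym => ne; rewrite (hw l j N M) // opprK.
move=> oM oN ne; rewrite !tens_comp; apply: (tens_opp (j := j)) => [k s t kj|s t].
  rewrite mcomp_koszul_atl // mcomp_koszul_atr //.
  case: (eqVneq k l) => [->|kl]; first by rewrite ltnNge ltnW //.
  by rewrite koszul_at_neq // /delta; case: (s =P t) => [->|]; rewrite ?mulr0.
rewrite mcomp_koszul_atr // mcomp_koszul_atl // koszul_at_eq jl /=.
have [->|/oM->] := eqVneq (M s t) 0; first by rewrite !mulr0 oppr0.
by case: is_edge; rewrite ?mulN1r ?mul1r ?opprK.
Qed.

Definition at_factor (G : sgraph) j (M : osimplex G -> osimplex G -> R) (l : 'I_n) s t : R :=
  if l == j then M s t else delta R s t.

(** Both operators carry the same sign at each factor before [j], and its square is one. *)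
Lemma tens_koszul_at_comp (G : sgraph) (M N : osimplex G -> osimplex G -> R)
    j (c : {ffun cube G n -> R^o}) :
  tens (koszul_at j N) (tens (koszul_at j M) c) = tens (at_factor j (mcomp M N)) c.
Proof.
rewrite tens_comp; apply: eq_tens => k s t; rewrite /at_factor; case: eqVneq => [->|kj].
  by apply: eq_bigr => x _; rewrite !koszul_at_eq.
by rewrite mcomp_koszul_atl // koszul_at_neq // mulrA -signr_addb addbb mul1r.
Qed.

Lemma tens_delta (G : sgraph) (c : {ffun cube G n -> R^o}) :
  tens (fun _ => @delta R G) c = c.
Proof.
apply/ffunP=> t; rewrite ffunE (bigD1 t) //= big1 => [|j _]; last by rewrite /delta eqxx.
rewrite mul1r big1 ?addr0 // => s st; have /existsP[j stj] : [exists j, s j != t j].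
  rewrite -negb_forall; apply: contraNN st => /forallP h.
  by apply/eqP/ffunP=> j; apply/eqP.
by rewrite (bigD1 j) //= /delta (negPf stj) !mul0r.
Qed.

(** Even matrices keep the parity of every factor and hence the Koszul sign of the boundary, so an
    identity is required at factor [j] alone, and there only on alternating functions. *)
Lemma tens_bdC (G H : sgraph) (F : 'I_n -> osimplex G -> osimplex H -> R) j
    (c : {ffun cube G n -> R^o}) :
    alternating c -> (forall l, even_mx (F l)) ->
    (forall t, alt_eq (mcomp (@bd R G) (F j) ^~ t) (mcomp (F j) (@bd R H) ^~ t)) ->
  tens (koszul_at j (@bd R H)) (tens F c) = tens F (tens (koszul_at j (@bd R G)) c).
Proof.
move=> alt_c Fe Fj; rewrite !tens_comp; apply: tens_alt_eq => // k t.
have [->|kj] := eqVneq k j.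
  apply: alt_eq_ext (alt_eq_sym (Fj t)) => s; apply: eq_bigr => x _;
    by rewrite koszul_at_eq.
apply: eq_alt_eq => s.
rewrite mcomp_koszul_atl // mcomp_koszul_atr //.
by have [->|/Fe->] := eqVneq (F k s t) 0; rewrite ?mulr0.
Qed.

End Koszul.

(** * Chain maps and homotopies *)

Section ChainMaps.
Variables (R : comNzRingType) (n : nat).

(** Commutation with the boundary is asked on chains only, because the operators built from matrices
    satisfy it only on alternating functions. *)
Record chain_map (P Q : pgraph) := ChainMap {
  cmap_fun :> {linear {ffun cube P n -> R^o} -> {ffun cube Q n -> R^o}};
  cmap_chain : forall p c, c \in chain p -> cmap_fun c \in chain p;
  cmap_boundary : forall p c, c \in chain p ->
    boundary (cmap_fun c) = cmap_fun (boundary c) }.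

Section HomologyMap.
Variables (P Q : pgraph) (T : chain_map P Q) (p : nat).

Lemma cmap_cycle_subproof (z : Defs.cycle R P n p) : T z \in is_cycle p.
Proof.
case/andP: (cycleP z) => zc /eqP z0.
by rewrite /in_mem /= /is_cycle cmap_chain //= (cmap_boundary _ zc) z0 linear0.
Qed.

Definition cmap_cycle (z : Defs.cycle R P n p) : Defs.cycle R Q n p := Cycle (cmap_cycle_subproof z).

Definition hmap (x : homology R P n p) : homology R Q n p := hclass (cmap_cycle (hrepr x)).

Lemma hmapE (z : Defs.cycle R P n p) : hmap (hclass z) = hclass (cmap_cycle z).
Proof.
apply/eqP; rewrite hclass_eq.
have : hrepr (hclass z) - z \in @is_boundary R P n p by rewrite -hclass_eq hreprK.
case/asboolP=> b bc zb; apply/asboolP; exists (T b); first exact: cmap_chain.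
by rewrite (cmap_boundary _ bc) -zb /= !linearB.
Qed.

Lemma hmap_linear : linear hmap.
Proof.
move=> a x y; rewrite -[x]hreprK -[y]hreprK.
have -> : a *: hclass (hrepr x) = hclass (a *: hrepr x) by apply: hscaleE.
rewrite -raddfD !hmapE.
have -> : a *: hclass (cmap_cycle (hrepr x)) = hclass (a *: cmap_cycle (hrepr x)).
  exact: hscaleE.
by rewrite -raddfD; congr hclass; apply: val_inj; rewrite /= linearP.
Qed.

HB.instance Definition _ := GRing.isLinear.Build R _ _ _ hmap hmap_linear.

End HomologyMap.

Lemma eq_hmap P Q (T T' : chain_map P Q) p (x : homology R P n p) :
  (forall c, c \in chain p -> T c = T' c) -> hmap T x = hmap T' x.
Proof.
move=> e; congr hclass; apply: val_inj; rewrite /= e //.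
by case/andP: (cycleP (hrepr x)).
Qed.

Lemma hmap_comp P Q S (T : chain_map P Q) (T' : chain_map Q S) (T'' : chain_map P S) p
    (x : homology R P n p) :
  (forall c, c \in chain p -> T' (T c) = T'' c) -> hmap T' (hmap T x) = hmap T'' x.
Proof.
move=> e; rewrite hmapE; congr hclass; apply: val_inj; rewrite /= e //.
by case/andP: (cycleP (hrepr x)).
Qed.

Lemma hmap_sum P Q (I : finType) (T : I -> chain_map P Q) (T' : chain_map P Q) p
    (x : homology R P n p) :
    (forall c, c \in chain p -> T' c = \sum_a T a c) ->
  hmap T' x = \sum_a hmap (T a) x.
Proof.
move=> e; rewrite -raddf_sum; congr hclass; apply: val_inj; rewrite /= e.
  by elim/big_rec2: _ => // a y u _ ->.
by case/andP: (cycleP (hrepr x)).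
Qed.

Lemma hmap_id P (T : chain_map P P) p (x : homology R P n p) :
    (forall c, c \in is_cycle p ->
       exists2 b, b \in chain p.+1 & T c - c = boundary b) ->
  hmap T x = x.
Proof.
move=> h; rewrite -[RHS]hreprK; apply/eqP; rewrite hclass_eq.
have [b bc e] := h _ (cycleP (hrepr x)).
by apply/asboolP; exists b.
Qed.

(* [F] commutes with the boundary only in its action on alternating functions;
   [fm_pts] keeps every pointed vertex among the factors of a cube. *)
Record factor_map (P Q : pgraph) (b : Q -> P) (F : osimplex P -> osimplex Q -> R) : Prop :=
  FactorMap {
    fm_even : even_mx F;
    fm_alt : forall t, is_edge t -> alt_eq (F ^~ (rev_simplex t)) (fun s => - F s t);
    fm_bd : forall t, alt_eq (mcomp (@bd R P) F ^~ t) (mcomp F (@bd R Q) ^~ t);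
    fm_pts : forall w, w \in pts Q ->
      forall t, F (inl (b w)) t != 0 -> t = inl w }.

Section TensChainMap.
Variables (P Q : pgraph) (b : Q -> P) (F : 'I_n -> osimplex P -> osimplex Q -> R).
Hypothesis hb : forall w, w \in pts Q -> b w \in pts P.
Hypothesis hF : forall j, factor_map b (F j).

(** A factor equal to [b w] can only be sent to [w], so anchored cubes go to anchored cubes;
    evenness preserves the dimension. *)
Lemma tens_chain p c : c \in chain p -> tens F c \in chain p.
Proof.
move=> cp; have [c1 c2 _] := chainP _ _ cp; apply/chainP; split.
- move=> t /tens_neq0[s cs Fst]; apply/forall_inP=> w wQ.
  have /existsP[j /eqP sj] := forall_inP (c1 _ cs) _ (hb wQ).
  by apply/existsP; exists j; apply/eqP/(fm_pts (hF j)) => //; rewrite -sj.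
- move=> t /tens_neq0[s cs Fst]; rewrite -(c2 _ cs); apply: eq_card => j.
  by rewrite !inE (fm_even (hF j) (Fst j)).
apply: alternating_tens; first exact: chain_alternating cp.
by move=> j t; apply: (fm_alt (hF j)).
Qed.

Lemma tens_boundary p c : c \in chain p -> boundary (tens F c) = tens F (boundary c).
Proof.
move=> cp; rewrite !boundary_tens linear_sum; apply: eq_bigr => j _.
apply: tens_bdC; first exact: chain_alternating cp.
  by move=> l; apply: fm_even (hF l).
exact: fm_bd (hF j).
Qed.

Definition tens_map : chain_map P Q := ChainMap tens_chain tens_boundary.

End TensChainMap.

(** * Homotopies relative to the pointed vertices *)

Section Homotopy.
Variables (P : pgraph) (F H : osimplex P -> osimplex P -> R).

(** [H] is a homotopy from the identity to [F] on the chains of the graph. Its vanishing on pointed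
    vertices keeps it inside the anchored subcomplex when it acts on one factor of a cube. *)
Record factor_homotopy : Prop := FactorHomotopy {
  fh_deg : forall s t, H s t != 0 -> ~~ is_edge s && is_edge t;
  fh_alt : forall s t, is_edge t -> H s (rev_simplex t) = - H s t;
  fh_pts : forall v t, v \in pts P -> H (inl v) t = 0;
  fh_eq : forall t, alt_eq (F ^~ t)
    (fun s => delta R s t + (mcomp H (@bd R P) s t + mcomp (@bd R P) H s t)) }.

Lemma factor_map_delta : factor_map id (@delta R P).
Proof.
split.
- exact: even_delta.
- move=> t te s; rewrite /delta; case: ifP => se; last first.
    rewrite (_ : (s == t) = false); last by apply: contraFF se => /eqP->.
    rewrite (_ : (s == rev_simplex t) = false) ?oppr0 //.
    by apply: contraFF se => /eqP->; rewrite is_edge_rev.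
  rewrite (inj_eq (inv_inj (@rev_simplexK P))) -[s in s == rev_simplex t]rev_simplexK.
  by rewrite (inj_eq (inv_inj (@rev_simplexK P))) opprK addrC.
- move=> t; apply: eq_alt_eq => s; rewrite /mcomp (bigD1 t) //= big1 => [|x]; last first.
    by rewrite /delta => /negPf->; rewrite mulr0.
  rewrite (bigD1 s) //= [X in _ = _ + X]big1 => [|x]; last first.
    by rewrite /delta eq_sym => /negPf->; rewrite mul0r.
  by rewrite /delta !eqxx mulr1 mul1r.
by move=> w wP t; rewrite /delta; case: (inl w =P t) => [->|_] //; rewrite eqxx.
Qed.

Hypotheses (hH : factor_homotopy) (hF : factor_map id F).

Lemma odd_fh : odd_mx H.
Proof. by move=> s t /(fh_deg hH) /andP[/negPf-> ->]. Qed.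

Lemma koszul_homotopy_chain j p (c : {ffun cube P n -> R^o}) :
  c \in chain p -> tens (koszul_at j H) c \in chain p.+1.
Proof.
move=> cp; have [c1 c2 _] := chainP _ _ cp.
have supp (s t : cube P n) : (forall l, koszul_at j H l (s l) (t l) != 0) ->
    [/\ ~~ is_edge (s j), is_edge (t j), H (s j) (t j) != 0 & forall l, l != j -> s l = t l].
  move=> h; have := h j; rewrite koszul_at_eq => Hj.
  have /andP[-> ->] := fh_deg hH Hj; split=> // l lj; have := h l.
  by rewrite koszul_at_neq // /delta; case: (s l =P t l) => // _; rewrite mulr0 eqxx.
apply/chainP; split.
- move=> t /tens_neq0[s cs /supp[_ _ Hj st]]; apply/forall_inP=> w wP.
  have /existsP[l /eqP sl] := forall_inP (c1 _ cs) _ wP.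
  apply/existsP; exists l; rewrite -st -?sl ?sl //.
  (* The factor equal to [w] is not [j], because [H] vanishes on pointed vertices; it is therefore
     left unchanged. *)
  by apply: contraNneq Hj => lj; rewrite -lj sl (fh_pts hH).
- move=> t /tens_neq0[s cs /supp[sj tj _ st]]; rewrite -(c2 _ cs) /cube_dim.
  rewrite (cardsD1 j) inE tj add1n; congr _.+1; apply: eq_card => l; rewrite !inE.
  by case: eqVneq => [->|/st->] //=; rewrite (negPf sj).
apply: alternating_tens; first exact: chain_alternating cp.
move=> l t te; have [->|lj] := eqVneq l j.
  by apply: eq_alt_eq => s; rewrite !koszul_at_eq (fh_alt hH).
move=> s; rewrite !koszul_at_neq // is_edge_rev.
have := fm_alt factor_map_delta te s; case: ifP => _ h; last by rewrite h mulrN.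
by rewrite -mulrBr h; ring.
Qed.

(** The operator [H] at [j], with its Koszul sign, anticommutes with the boundary terms at all other
    factors. The terms at [j] add up to [F] minus the identity by [fh_eq]. *)
Lemma at_factor_homotopic j p (c : {ffun cube P n -> R^o}) : c \in is_cycle p ->
  exists2 b, b \in chain p.+1 & tens (at_factor j F) c - c = boundary b.
Proof.
case/andP=> cp /eqP c0; exists (tens (koszul_at j H) c); first exact: koszul_homotopy_chain.
have alt_c := chain_alternating cp.
have : boundary (tens (koszul_at j H) c) + tens (koszul_at j H) (boundary c) =
    tens (at_factor j (mcomp H (@bd R P))) c + tens (at_factor j (mcomp (@bd R P) H)) c.
  rewrite !boundary_tens linear_sum -big_split (bigD1 j) //= big1 ?addr0.
    by rewrite !tens_koszul_at_comp.
  move=> l lj; rewrite (tens_koszul_atC _ odd_fh (@odd_bd R P)) 1?eq_sym //.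
  by rewrite addNr.
rewrite c0 linear0 addr0 => ->.
have -> : tens (at_factor j F) c = tens (at_factor j (fun s t => delta R s t +
    (mcomp H (@bd R P) s t + mcomp (@bd R P) H s t))) c.
  apply: tens_alt_eq => // l t; rewrite /at_factor; case: eqP => _; first exact: (fh_eq hH).
  exact: eq_alt_eq.
rewrite (@tens_at _ _ _ _ j _ (fun _ => @delta R P)
  (at_factor j (fun s t => mcomp H (@bd R P) s t + mcomp (@bd R P) H s t)) 1); last first.
- by move=> s t; rewrite /at_factor eqxx mul1r.
- by move=> l s t lj; rewrite /at_factor (negPf lj).
- by move=> l s t lj; rewrite /at_factor (negPf lj).
rewrite tens_delta scale1r addrC addKr.
rewrite (@tens_at _ _ _ _ j _ (at_factor j (mcomp H (@bd R P)))
  (at_factor j (mcomp (@bd R P) H)) 1) ?scale1r //.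
- by move=> l s t lj; rewrite /at_factor (negPf lj).
- by move=> l s t lj; rewrite /at_factor (negPf lj).
by move=> s t; rewrite /at_factor eqxx mul1r.
Qed.

Lemma tens_homotopic p (c : {ffun cube P n -> R^o}) : c \in is_cycle p ->
  exists2 b, b \in chain p.+1 & tens (fun _ => F) c - c = boundary b.
Proof.
(* [T k] applies [F] to the first [k] factors; passing from [k] to [k.+1] is a homotopy at one
   factor. *)
pose T k (l : 'I_n) : osimplex P -> osimplex P -> R := if (l < k)%N then F else @delta R P.
have hT k l : factor_map id (T k l).
  by rewrite /T; case: ifP => _ //; apply: factor_map_delta.
move=> cz; suff Tn k : (k <= n)%N ->
    exists2 b, b \in chain p.+1 & tens (T k) c - c = boundary b.
  have [b bp bE] := Tn _ (leqnn n); exists b => //; rewrite -bE; congr (_ - _).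
  by apply: eq_tens => j s t; rewrite /T ltn_ord.
have [_ cD] := chain_submod R P n p.+1.
elim: k => [_|k IHk kn].
  exists 0; first by case: (chain_submod R P n p.+1).
  by rewrite linear0 (eq_tens (F' := fun _ => @delta R P)) // tens_delta subrr.
have [b bp bE] := IHk (ltnW kn).
have Tz : tens (T k) c \in is_cycle p.
  case/andP: cz => cp /eqP c0.
  by rewrite /in_mem /= /is_cycle (tens_chain _ (hT k)) //= (tens_boundary (hT k) cp) c0 linear0.
have [d dp dE] := at_factor_homotopic (Ordinal kn) Tz.
exists (1 *: b + d); first exact: cD.
rewrite scale1r linearD /= -bE -dE tens_comp [in RHS]addrC addrA subrK; congr (_ - _).
apply: eq_tens => j s t; rewrite /T; have [->|jk] := eqVneq j (Ordinal kn).
  rewrite ltnn ltnSn -[LHS](mcomp_deltal F).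
  by apply: eq_bigr => x _; rewrite /at_factor eqxx.
rewrite ltnS [(j <= k)%N]leq_eqVlt (negPf jk : (j == k :> nat) = false) /=.
rewrite -[LHS]mcomp_deltar.
by apply: eq_bigr => x _; rewrite /at_factor (negPf jk).
Qed.

End Homotopy.

End ChainMaps.

(** * Decomposition of the identity *)

Definition eadj (G : sgraph) (u v : G) : bool := (u == v) || adj u v.

(* Every vertex [v] is joined to the base point of its component by a walk of length
   at most two, through [mid v]. *)
Record contraction (G : sgraph) := Contraction {
  base : G -> G;
  mid : G -> G;
  base_mid : forall v, eadj (base v) (mid v);
  mid_end : forall v, eadj (mid v) v;
  base_adj : forall u v, adj u v -> base u = base v }.

Section Paths.
Variables (R : comNzRingType) (G : sgraph) (d : contraction G).

(** The oriented edge from [u] to [v] as an alternating chain. It is zero when [u = v], which allows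
    degenerate steps in a path. *)
Definition arc_chain (u v : G) (s : osimplex G) : R :=
  if s is inr e then (val e == (u, v))%:R - (val e == (v, u))%:R else 0.

Definition path_chain (v : G) (s : osimplex G) : R :=
  arc_chain (base d v) (mid d v) s + arc_chain (mid d v) v s.

(** For adjacent [u] and [v], which share a base point, this is the closed walk from the base point
    to [u], across to [v], and back. *)
Definition loop (u v : G) (s : osimplex G) : R :=
  arc_chain u v s - path_chain v s + path_chain u s.

Lemma arc_rev u v s : arc_chain u v (rev_simplex s) = - arc_chain u v s.
Proof.
case: s => [w|[[a b] ab]] /=; rewrite ?oppr0 // !xpair_eqE.
by rewrite opprB ![(b == _) && _]andbC.
Qed.

Lemma path_chain_rev v s : path_chain v (rev_simplex s) = - path_chain v s.
Proof. by rewrite /path_chain !arc_rev opprD. Qed.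

Lemma loop_rev u v s : loop u v (rev_simplex s) = - loop u v s.
Proof. by rewrite /loop !(arc_rev, path_chain_rev); ring. Qed.

Lemma arcC u v s : arc_chain v u s = - arc_chain u v s.
Proof. by case: s => [w|e] /=; rewrite ?oppr0 // opprB. Qed.

Lemma loopC u v s : loop v u s = - loop u v s.
Proof. by rewrite /loop (arcC u v); ring. Qed.

Lemma arcE (e : {e : G * G | adj e.1 e.2}) s :
  arc_chain (val e).1 (val e).2 s = (inr e == s)%:R - (rev_simplex (inr e) == s)%:R.
Proof.
case: s => [w|f] /=; first by rewrite subrr.
rewrite -surjective_pairing; congr ((_ : bool)%:R - (_ : bool)%:R).
  by apply/eqP/eqP => [/val_inj-> //|h]; case: h => ->.
apply/eqP/eqP => [h|h]; first by congr inr; apply: val_inj.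
by case: h => <-.
Qed.

(** With [A] a column of [bd] this is the boundary of an arc. The general [A], depending only on the
    target of an edge, also covers the edge values of [vertex_piece]. *)
Lemma sum_arc u v (A : osimplex G -> R) (g : G -> R) :
    eadj u v -> (forall e, A (inr e) = g (val e).2) ->
  \sum_s arc_chain u v s * A s = g v - g u.
Proof.
move=> uv gA; case/orP: uv => [/eqP<-|uv].
  rewrite subrr big1 // => -[w|e] _ /=; first by rewrite mul0r.
  by rewrite subrr mul0r.
pose e : {e : G * G | adj e.1 e.2} := exist _ (u, v) uv.
have -> : g v - g u = A (inr e) - A (rev_simplex (inr e)) by rewrite !gA.
under eq_bigr do rewrite (arcE e) mulrBl.
rewrite sumrB (bigD1 (inr e)) //= [X in _ + X - _]big1 => [|s]; last first.
  by rewrite eq_sym => /negPf->; rewrite mul0r.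
rewrite eqxx mul1r addr0; congr (_ - _).
rewrite (bigD1 (rev_simplex (inr e))) //= [X in _ + X]big1 => [|s]; last first.
  by rewrite eq_sym => /negPf->; rewrite mul0r.
by rewrite eqxx mul1r addr0.
Qed.

Lemma sum_path_chain v (A : osimplex G -> R) (g : G -> R) :
    (forall e, A (inr e) = g (val e).2) ->
  \sum_s path_chain v s * A s = g v - g (base d v).
Proof.
move=> gA; under eq_bigr do rewrite mulrDl.
rewrite big_split /= (sum_arc (base_mid d v) gA) (sum_arc (mid_end d v) gA).
by ring.
Qed.

(** The contributions of the arc and of the two paths telescope, since [u] and [v] have the same
    base point. *)
Lemma sum_loop u v (A : osimplex G -> R) (g : G -> R) :
    adj u v -> (forall e, A (inr e) = g (val e).2) ->
  \sum_s loop u v s * A s = 0.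
Proof.
move=> uv gA; under eq_bigr do rewrite mulrDl mulrBl.
rewrite big_split sumrB /= (sum_path_chain v gA) (sum_path_chain u gA).
rewrite (sum_arc _ gA) ?(base_adj d uv); first by ring.
by rewrite /eadj uv orbT.
Qed.

Lemma bd_arc (e : {e : G * G | adj e.1 e.2}) w :
  bd R (inr e) (inl w) = ((val e).2 == w)%:R.
Proof. by []. Qed.

Lemma path_chain_vertex v w : path_chain v (inl w) = 0.
Proof. by rewrite /path_chain /= addr0. Qed.

Lemma loop_vertex u v w : loop u v (inl w) = 0.
Proof. by rewrite /loop !path_chain_vertex /= subr0 addr0. Qed.

End Paths.

(** * Vertex pieces and loop pieces *)

Section Pieces.
Variables (R : comNzRingType) (P Q : pgraph) (dP : contraction P) (dQ : contraction Q).
Variables (b : Q -> P) (g : P -> Q).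

(** The part of the retraction living on the component with base point [k]. For an edge only the
    target end is written; the source end comes from the reversed edge with the opposite sign. *)
Definition vertex_piece (k : P) (l : Q) (s : osimplex P) (t : osimplex Q) : R :=
  match s with
  | inl v => ((base dP v == k) && (t == inl (if v \in pts P then g v else l)))%:R
  | inr e => ((base dP (val e).2 == k) && ((val e).2 \in pts P))%:R *
               path_chain R dQ (g (val e).2) t
  end.

Definition loop_piece (e : {e : P * P | adj e.1 e.2}) (f : {e : Q * Q | adj e.1 e.2})
    (s : osimplex P) (t : osimplex Q) : R :=
  (s == inr e)%:R * loop R dQ (val f).1 (val f).2 t.

Lemma mcomp_bdl (F : osimplex P -> osimplex Q -> R) s t :
  mcomp (@bd R P) F s t = if is_edge s then F (target s) t else 0.
Proof.
rewrite /mcomp; case: ifP => se; last first.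
  by rewrite big1 // => x _; rewrite /bd se mul0r.
rewrite (bigD1 (target s)) //= /bd se eqxx mul1r big1 ?addr0 // => x.
by rewrite eq_sym => /negPf->; rewrite mul0r.
Qed.

Lemma mcomp_bdr_edge (F : osimplex P -> osimplex Q -> R) s e :
  mcomp F (@bd R Q) s (inr e) = 0.
Proof.
rewrite /mcomp big1 // => x _; rewrite /bd (_ : _ && _ = false) ?mulr0 //.
by apply/negP=> /andP[_ /eqP h]; have := is_edge_target x; rewrite h.
Qed.

(** An edge goes to the signed paths at its pointed ends. Each such path runs from [l] to the image
    of the pointed end, and these starting points account for the unpointed ends, which are all sent
    to [l]. *)
Lemma vertex_piece_factor k l :
    (forall v, v \in pts P -> base dP v = k -> base dQ (g v) = l) ->
    (forall w, w \in pts Q -> b w \in pts P /\ g (b w) = w) ->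
  factor_map b (vertex_piece k l).
Proof.
move=> kl gb; split.
- case=> [v|e] [w|f] //=; first by rewrite andbF eqxx.
  by rewrite path_chain_vertex mulr0 eqxx.
- case=> [w|f] // _; apply: eq_alt_eq => -[v|e] /=; first by rewrite andbF oppr0.
  by rewrite -[inr _]/(rev_simplex (inr f)) path_chain_rev mulrN.
- case=> [w|f] [v|e]; rewrite !mcomp_bdl /=.
  + by rewrite /mcomp big1 // => -[x|x] _; rewrite /= ?andbF ?mul0r // mulr0.
  + have E (v : P) : \sum_x (((base dP v == k) && (v \in pts P))%:R *
         path_chain R dQ (g v) x) * bd R x (inl w) =
       ((base dP v == k) && (v \in pts P))%:R * ((g v == w)%:R - (l == w)%:R).
      under eq_bigr do rewrite -mulrA.
      rewrite -mulr_sumr (sum_path_chain dQ (g v) (g := fun u => (u == w)%:R)); last first.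
        by move=> e0; apply: bd_arc.
      by case: eqP => //= [vk|_]; case vP: (v \in pts P); rewrite ?mul0r // (kl _ vP vk).
    rewrite /mcomp !E (base_adj dP (valP e)).
    case: eqP => _ /=; last by rewrite !mul0r.
    rewrite ![inl w == _]eq_sym.
    rewrite ![inl _ == inl w](inj_eq (@inl_inj _ _)).
    by case: ifP => _; case: ifP => _; rewrite ?mul0r ?mul1r; ring.
  + by rewrite mcomp_bdr_edge.
  + by rewrite !mcomp_bdr_edge /= !andbF.
move=> w /gb[bw gbw] t /=; rewrite bw gbw.
by case: (t =P inl w) => // _; rewrite andbF eqxx.
Qed.

(** A loop has zero boundary and vertices are sent to zero, so both sides of the commutation with
    [bd] vanish. *)
Lemma loop_piece_factor e f : factor_map b (loop_piece e f).
Proof.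
split.
- move=> s [w|f']; first by rewrite /loop_piece loop_vertex mulr0 eqxx.
  by rewrite /loop_piece; case: (s =P inr e) => [->|_] //; rewrite mul0r eqxx.
- move=> t _; apply: eq_alt_eq => s.
  by rewrite /loop_piece loop_rev mulrN.
- move=> t; apply: eq_alt_eq => s; rewrite mcomp_bdl.
  have -> : (if is_edge s then loop_piece e f (target s) t else 0) = 0.
    by case: s => [v|e'] //=; rewrite /loop_piece mul0r.
  case: t => [w|f']; last by rewrite mcomp_bdr_edge.
  rewrite /mcomp; under eq_bigr do rewrite -mulrA.
  rewrite -mulr_sumr (sum_loop dQ (valP f) (g := fun u => (u == w)%:R)) ?mulr0 //.
by move=> w _ t; rewrite /loop_piece mul0r eqxx.
Qed.

End Pieces.

Lemma factor_map_sum (R : comNzRingType) (P Q : pgraph) (b : Q -> P) (I : finType)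
    (F : I -> osimplex P -> osimplex Q -> R) :
  (forall a, factor_map b (F a)) -> factor_map b (fun s t => \sum_a F a s t).
Proof.
move=> hF; split.
- move=> s t; have [/existsP[a Fa] _|] := boolP [exists a, F a s t != 0].
    exact: (fm_even (hF a)).
  rewrite negb_exists => /forallP h.
  by rewrite big1 ?eqxx // => a _; apply/eqP; rewrite -[_ == _]negbK h.
- move=> t te s; case: ifP => se.
    rewrite opprK -sumrB -sumrN -big_split; apply: eq_bigr => a _ /=.
    by have := fm_alt (hF a) te s; rewrite se => ->; rewrite opprK.
  rewrite -sumrN; apply: eq_bigr => a _.
  by have := fm_alt (hF a) te s; rewrite se.
- move=> t; have L s : mcomp (@bd R P) (fun s t => \sum_a F a s t) s t =
      \sum_a mcomp (@bd R P) (F a) s t.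
    by rewrite /mcomp exchange_big; apply: eq_bigr => x _; rewrite mulr_sumr.
  have M s : mcomp (fun s t => \sum_a F a s t) (@bd R Q) s t =
      \sum_a mcomp (F a) (@bd R Q) s t.
    by rewrite /mcomp exchange_big; apply: eq_bigr => x _; rewrite mulr_suml.
  move=> s; rewrite !L !M; case: ifP => se.
    rewrite -!sumrB; apply: eq_bigr => a _.
    by have := fm_bd (hF a) t s; rewrite se.
  by apply: eq_bigr => a _; have := fm_bd (hF a) t s; rewrite se.
move=> w wQ t; have [/existsP[a Fa] _|] := boolP [exists a, F a (inl (b w)) t != 0].
  exact: (fm_pts (hF a)).
rewrite negb_exists => /forallP h.
by rewrite big1 ?eqxx // => a _; apply/eqP; rewrite -[_ == _]negbK h.
Qed.

Lemma factor_map0 (R : comNzRingType) (P Q : pgraph) (b : Q -> P) :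
  factor_map b (fun _ _ => 0 : R).
Proof.
split=> [s t|t _|t|w _ t]; rewrite ?eqxx //; apply: eq_alt_eq => s; first by rewrite oppr0.
by rewrite /mcomp !big1 // => x _; rewrite ?mulr0 ?mul0r.
Qed.

Section Decomposition.
Variables (R : comNzRingType) (P : pgraph) (d : contraction P).

(** Both orientations of an edge index a piece; setting the negative one to zero counts each edge
    once. *)
Definition piece (a : osimplex P) : osimplex P -> osimplex P -> R :=
  match a with
  | inl k => vertex_piece R d d id k k
  | inr e => if positive (inr e) then loop_piece R d e e else fun _ _ => 0
  end.

Lemma piece_factor a : factor_map id (piece a).
Proof.
case: a => [k|e]; first by apply: vertex_piece_factor.
by rewrite /piece; case: ifP => _; [apply: loop_piece_factor | apply: factor_map0].
Qed.

Definition contracting_homotopy (s t : osimplex P) : R :=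
  if s is inl v then - (v \notin pts P)%:R * path_chain R d v t else 0.

(** On vertices the pieces add up to the retraction that fixes pointed vertices and moves the others
    to their base points. On an edge, the loop gives the edge corrected by the paths at both ends,
    and the vertex pieces cancel the correction at pointed ends; what is left over is the homotopy
    term at unpointed ends. *)
Lemma piece_homotopy :
  factor_homotopy (fun s t => \sum_a piece a s t) contracting_homotopy.
Proof.
split.
- case=> [v|e] [w|f] //=; rewrite ?path_chain_vertex ?mulr0 ?eqxx //.
- case=> [v|e] t te /=; last by rewrite oppr0.
  by rewrite path_chain_rev mulrN.
- by move=> v t vP; rewrite /= vP oppr0 mul0r.
have Ev v t : \sum_a piece a (inl v) t =
    (t == inl (if v \in pts P then v else base d v))%:R.
  rewrite (bigD1 (inl (base d v))) //= eqxx big1 ?addr0 // => -[k|e] /= ke.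
    by rewrite eq_sym -[_ == _]negbK ke.
  by case: ifP => // _; rewrite /loop_piece mul0r.
have Ee e t : \sum_a piece a (inr e) t =
    ((val e).2 \in pts P)%:R * path_chain R d (val e).2 t +
    (positive (inr e))%:R * loop R d (val e).1 (val e).2 t.
  rewrite (bigD1 (inl (base d (val e).2))) //= eqxx (bigD1 (inr e)) //=.
  rewrite big1 ?addr0; last first.
    case=> [k|f] /andP[ke].
      by move=> _ /=; rewrite [base d _ == k]eq_sym (negPf (ke : k != base d (val e).2)) mul0r.
    move=> fe /=; case: ifP => // _; rewrite /loop_piece.
    by rewrite [inr e == _]eq_sym (negPf fe) mul0r.
  by congr (_ + _); case: ifP => _; rewrite ?mul0r // /loop_piece eqxx.
have Hbd v t : mcomp contracting_homotopy (@bd R P) (inl v) t =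
    - (v \notin pts P)%:R * \sum_s path_chain R d v s * bd R s t.
  by rewrite mulr_sumr; apply: eq_bigr => s _; rewrite mulrA.
have Hbd0 e t : mcomp contracting_homotopy (@bd R P) (inr e) t = 0.
  by rewrite /mcomp big1 // => s _; rewrite mul0r.
move=> t [v|e] /=.
  rewrite Ev Hbd mcomp_bdl addr0 /delta; case: t => [w|f]; last first.
    rewrite (_ : \sum_s _ = 0) ?mulr0 ?addr0 //.
    exact: (mcomp_bdr_edge (fun=> path_chain R d v) (inl v) f).
  rewrite (sum_path_chain d v (g := fun u => (u == w)%:R)) //.
  rewrite !(inj_eq (@inl_inj _ _)) ![_ == w]eq_sym.
  by case: ifP => _ /=; ring.
(* Exactly one of the two orientations is positive, so it remains to distinguish which one it is and
   which ends are pointed. *)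
have pr := @positive_rev P (inr e) isT; rewrite /rev_simplex in pr.
rewrite !Ee !Hbd0 !mcomp_bdl pr /= !add0r (loopC R d (sval e).1) /loop arcE /delta /=.
case: (_ < _)%N; case: (_ \in pts P); case: (_ \in pts P); rewrite /=; ring.
Qed.

Lemma homology_decomposition n p (x : homology R P n p) :
  x = \sum_(w : {ffun 'I_n -> osimplex P})
        hmap (tens_map (fun _ => id) (fun j => piece_factor (w j))) x.
Proof.
rewrite -(@hmap_sum _ _ _ _ _ _ (tens_map (fun _ => id)
  (fun _ : 'I_n => factor_map_sum piece_factor))) => [|c _]; last exact: tens_sum.
by apply/esym/hmap_id => c; apply: (tens_homotopic piece_homotopy (factor_map_sum piece_factor)).
Qed.

End Decomposition.

(** * Supports of the pieces *)

Lemma sum_inj_support (V : nmodType) (I J : finType) (h : J -> I) (A : I -> V) :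
    injective h -> (forall i, A i != 0 -> exists j, i = h j) ->
  \sum_i A i = \sum_j A (h j).
Proof.
move=> h_inj suppA; rewrite (bigID (mem (codom h))) /= [X in _ + X]big1 ?addr0.
  by rewrite -big_uniq ?big_image // map_inj_uniq ?enum_uniq.
move=> i; have [//|/suppA[j ->]] := eqVneq (A i) 0.
by rewrite codom_f.
Qed.

Section Restriction.
Variables (R : comNzRingType) (P Q : pgraph) (f : full_embedding P Q).

Lemma push_rev_simplex t : push_simplex f (rev_simplex t) = rev_simplex (push_simplex f t).
Proof. by case: t => //= e; congr inr; apply: val_inj. Qed.

Lemma push_target t : push_simplex f (target t) = target (push_simplex f t).
Proof. by case: t. Qed.

Lemma push_simplex_inj : injective (push_simplex f).
Proof.
case=> [v|e] [w|e'] //= h; first by have [] := h => /emb_inj ->.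
case: h => /emb_inj h1 /emb_inj h2; congr inr; apply: val_inj.
by rewrite [val e]surjective_pairing h1 h2 -surjective_pairing.
Qed.

Definition restrict_mx (F : osimplex Q -> osimplex Q -> R) (s : osimplex Q) (t : osimplex P) : R :=
  F s (push_simplex f t).

Lemma emb_mem w : w \in pts P -> f w \in pts Q.
Proof. by move=> wP; rewrite -(emb_pts f) imset_f. Qed.

(** Everything reached by [F] lies in the image of [f], so the sum over intermediate simplices in
    the composition with [bd] can be taken over [P]. *)
Lemma restrict_factor F : factor_map id F ->
    (forall s t, F s t != 0 -> exists u, t = push_simplex f u) ->
  factor_map f (restrict_mx F).
Proof.
move=> hF suppF; split.
- by move=> s t /(fm_even hF); rewrite is_edge_push.
- move=> t te; rewrite /restrict_mx push_rev_simplex.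
  by apply: (fm_alt hF); rewrite is_edge_push.
- move=> t; apply: alt_eq_ext (fm_bd hF (push_simplex f t)) => s.
    by rewrite /mcomp; apply: eq_bigr.
  rewrite /mcomp (sum_inj_support push_simplex_inj) => [|x].
    apply: eq_bigr => x _; rewrite /bd is_edge_push -push_target.
    by rewrite (inj_eq push_simplex_inj).
  have [->|/suppF//] := eqVneq (F s x) 0; first by rewrite mul0r eqxx.
by move=> w /emb_mem wQ t /(fm_pts hF wQ); apply: (@push_simplex_inj t (inl w)).
Qed.

Lemma push_tens_restrict n (F : 'I_n -> osimplex Q -> osimplex Q -> R) c :
    (forall j s t, F j s t != 0 -> exists u, t = push_simplex f u) ->
  push_chain f (tens (fun j => restrict_mx (F j)) c) = tens F c.
Proof.
move=> suppF; apply/ffunP=> t; rewrite ffunE.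
have push_inj : injective (@push_cube P Q f n).
  move=> s s' /ffunP h; apply/ffunP=> j; apply: push_simplex_inj.
  by have := h j; rewrite !ffunE.
have [/codomP[u ->]|tP] := boolP (t \in codom (@push_cube P Q f n)).
  rewrite (big_pred1 u) => [|s]; last by rewrite /= (inj_eq push_inj).
  rewrite !ffunE; apply: eq_bigr => s _; congr (_ * _); apply: eq_bigr => j _.
  by rewrite ffunE.
rewrite big_pred0 => [|s]; last first.
  by apply: contraNF tP => /eqP <-; apply: codom_f.
apply/esym/eqP; apply: contraNT tP => /tens_neq0[s _ Fst].
have tj j : {u | push_simplex f u == t j}.
  apply: sigW; have [u ->] := suppF j _ _ (Fst j).
  by exists u.
apply/codomP; exists [ffun j => sval (tj j)]; apply/ffunP=> j.
by rewrite !ffunE; apply/esym/eqP/(svalP (tj j)).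
Qed.

Lemma homology_push_restrict n p (F : 'I_n -> osimplex Q -> osimplex Q -> R)
    (hF : forall j, factor_map id (F j))
    (hG : forall j, factor_map f (restrict_mx (F j))) (x : homology R Q n p) :
    (forall j s t, F j s t != 0 -> exists u, t = push_simplex f u) ->
  homology_push f (hmap (tens_map emb_mem hG) x) = hmap (tens_map (fun _ => id) hF) x.
Proof.
move=> suppF; rewrite homology_pushE; congr hclass; apply: val_inj => /=.
exact: push_tens_restrict.
Qed.

End Restriction.

Section CodedGraphs.
Variables (m : nat) (a : {ffun 'I_m * 'I_m -> bool}).

(** Symmetrising and removing the diagonal turns every Boolean table into a graph, so the graphs on
    [m] vertices are covered by a finite type of codes. *)
Definition coded_adj (x y : 'I_m) : bool := (x != y) && (a (x, y) || a (y, x)).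

Lemma coded_sym : symmetric coded_adj.
Proof. by move=> x y; rewrite /coded_adj eq_sym orbC. Qed.

Lemma coded_irr : irreflexive coded_adj.
Proof. by move=> x; rewrite /coded_adj eqxx. Qed.

Definition coded_pgraph (K : {set 'I_m}) : pgraph := @PGraph (SGraph coded_sym coded_irr) K.

End CodedGraphs.

Lemma induced_coded (Q : pgraph) (W : {set Q}) : pts Q \subset W ->
  exists (a : {ffun 'I_#|W| * 'I_#|W| -> bool}) (K : {set 'I_#|W|})
         (f : full_embedding (coded_pgraph a K) Q), forall w, w \in W -> exists i, f i = w.
Proof.
move=> QW; pose a := [ffun x : 'I_#|W| * 'I_#|W| => adj (enum_val x.1) (enum_val x.2)].
pose K := [set x : 'I_#|W| | enum_val x \in pts Q].
have a_adj (x y : coded_pgraph a K) : adj (enum_val x) (enum_val y) = adj x y.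
  rewrite /= /coded_adj !ffunE /= [in X in _ || X]adj_sym orbb andb_idl //.
  by apply: contraTneq => ->; rewrite adj_irr.
have a_pts : (enum_val : coded_pgraph a K -> Q) @: K = pts Q.
  apply/setP=> v; apply/imsetP/idP => [[x xK ->]|vQ]; first by rewrite inE in xK.
  have vW := fintype.subsetP QW _ vQ.
  by exists (enum_rank_in vW v); rewrite ?inE enum_rankK_in.
have a_inj : injective (enum_val : coded_pgraph a K -> Q) by apply: enum_val_inj.
exists a, K, (FullEmbedding a_inj a_adj a_pts) => w wW.
by exists (enum_rank_in wW w); rewrite /= enum_rankK_in.
Qed.

Lemma card_pts_emb (P Q : pgraph) (f : full_embedding P Q) : #|pts P| = #|pts Q|.
Proof. by rewrite -(emb_pts f) card_imset //; apply: emb_inj. Qed.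

(** * Vertices met by a piece *)

Section PieceSupport.
Variables (R : comNzRingType) (P : pgraph) (d : contraction P).

Definition path_set (v : P) : {set P} := [set base d v; mid d v; v].

Definition piece_set (a : osimplex P) : {set P} :=
  match a with
  | inl k => [set k]
  | inr e => path_set (val e).1 :|: path_set (val e).2
  end.

Definition support_set n (w : {ffun 'I_n -> osimplex P}) : {set P} :=
  (\bigcup_(k in pts P) path_set k) :|: \bigcup_(j < n) piece_set (w j).

Definition ends (s : osimplex P) : {set P} :=
  match s with inl v => [set v] | inr e => [set (val e).1; (val e).2] end.

Lemma arc_support u v s : arc_chain R u v s != 0 -> ends s \subset [set u; v].
Proof.
case: s => [w|[[x y] xy]] /=; first by rewrite eqxx.
have [[-> ->] _|] := eqVneq (x, y) (u, v); first by [].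
have [[-> ->] _|_ _] := eqVneq (x, y) (v, u); last by rewrite subrr eqxx.
by rewrite finset.setUC.
Qed.

Lemma path_chain_support v s : path_chain R d v s != 0 -> ends s \subset path_set v.
Proof.
rewrite /path_chain; have [->|/arc_support h _] := eqVneq (arc_chain R (base d v) (mid d v) s) 0.
  rewrite add0r => /arc_support h; apply: fintype.subset_trans h _.
  by apply/fintype.subsetP=> x; rewrite !inE => /orP[]->; rewrite ?orbT.
apply: fintype.subset_trans h _.
by apply/fintype.subsetP=> x; rewrite !inE => /orP[]->; rewrite ?orbT.
Qed.

Lemma piece_support a s t : piece R d a s t != 0 ->
  ends t \subset (\bigcup_(k in pts P) path_set k) :|: piece_set a.
Proof.
case: a => [k|e].
  case: s => [v|e] /=.
    case: (base d v =P k) => [<-|_] /=; last by rewrite eqxx.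
    case: (t =P _) => [->|_] /=; last by rewrite eqxx.
    case: ifP => vP _; rewrite finset.sub1set !inE ?eqxx ?orbT //.
    apply/orP; left; apply/bigcupP; exists v => //.
    by rewrite !inE eqxx orbT.
  set v := (sval e).2; case vP: (v \in pts P); last by rewrite andbF mul0r eqxx.
  have [->|/path_chain_support h _] := eqVneq (path_chain R d v t) 0.
    by rewrite mulr0 eqxx.
  apply: fintype.subset_trans h _; apply: subsetU; apply/orP; left.
  exact: (finset.bigcup_sup v).
rewrite /piece; case: ifP => _; last by rewrite eqxx.
rewrite /loop_piece /loop => h; apply: fintype.subset_trans (finset.subsetUr _ _).
have [h1|/arc_support h1] := eqVneq (arc_chain R (val e).1 (val e).2 t) 0; last first.
  apply: fintype.subset_trans h1 _; apply/fintype.subsetP=> x.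
  by rewrite !inE => /orP[]->; rewrite ?orbT.
have [h2|/path_chain_support h2] := eqVneq (path_chain R d (val e).2 t) 0; last first.
  by apply: fintype.subset_trans h2 (finset.subsetUr _ _).
have [h3|/path_chain_support h3] := eqVneq (path_chain R d (val e).1 t) 0; last first.
  by apply: fintype.subset_trans h3 (finset.subsetUl _ _).
by move: h; rewrite h1 h2 h3 subr0 addr0 mulr0 eqxx.
Qed.

Lemma card_path_set v : (#|path_set v| <= 3)%N.
Proof.
rewrite /path_set finset.setUC cardsU1; apply: (leq_add (leq_b1 _)).
by apply: (leq_trans (leq_card_setU _ _)); rewrite !cards1.
Qed.

Lemma card_bigcup_le (I : finType) (A : {pred I}) (B : I -> {set P}) N :
  (forall i, #|B i| <= N)%N -> (#|\bigcup_(i in A) B i| <= #|A| * N)%N.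
Proof.
move=> BN; rewrite -sum_nat_const.
elim/big_rec2: _ => [|i k X _ h]; first by rewrite cards0.
by apply: (leq_trans (leq_card_setU _ _)); apply: leq_add.
Qed.

(** A path has at most three vertices. There is one path for each pointed vertex and at most two for
    each of the [n] factors. *)
Lemma card_support_set n (w : {ffun 'I_n -> osimplex P}) :
  (#|support_set w| <= #|pts P| * 3 + n * 6)%N.
Proof.
apply: (leq_trans (leq_card_setU _ _)); apply: leq_add.
  exact: card_bigcup_le card_path_set.
have := @card_bigcup_le 'I_n predT (fun j => piece_set (w j)) 6; rewrite card_ord; apply.
move=> j; case: (w j) => [k|e]; first by rewrite cards1.
apply: (leq_trans (leq_card_setU _ _)).
exact: (leq_add (card_path_set _) (card_path_set _)).
Qed.

End PieceSupport.

(** * Cographs *)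

Section Cographs.

Definition p4_free (G : sgraph) : Prop := forall a b c d : G,
  a != c -> b != d -> adj a b -> adj b c -> adj c d -> ~~ adj a c -> ~~ adj b d -> adj a d.

Lemma cograph_p4_free G : cograph G -> p4_free G.
Proof.
elim=> {G} [|G H _ hG _ hH|G _ hG|G H [f [g fK gK] fadj] _ hG] a b c d.
- by case: a b => [] [].
- by case: a b c d => a [] b [] c [] d //; [apply: hG | apply: hH].
- rewrite /= /compl_adj => ac bd /andP[ab nab] /andP[bc nbc] /andP[cd ncd].
  rewrite ac bd /= !negbK => ac' bd'; apply/andP; split.
    by apply: contraTneq ac' => ->; rewrite adj_sym.
  apply: contra nbc => ad'.
  (* The complement of an induced path [a], [b], [c], [d] is the induced path [b], [d], [a], [c]. *)
  by apply: (hG b d a c) => //; rewrite 1?eq_sym // adj_sym.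
have gadj x y : adj (g x) (g y) = adj x y by rewrite -fadj !gK.
have g_inj := can_inj gK.
rewrite -!gadj -(inj_eq g_inj) -(inj_eq g_inj b); exact: hG.
Qed.

Lemma cograph_inhabited G : cograph G -> exists v : G, true.
Proof.
elim=> {G} [|G H _ [v _] _ _|//|G H [f _ _] _ [v _]]; first by exists tt.
  by exists (inl v).
by exists (f v).
Qed.

Definition near (G : sgraph) (u v : G) : bool := [exists w, eadj u w && eadj w v].

(** A walk [u], [w], [x], [y] of length three either shortens through a coincidence or a chord, or
    else has adjacent ends because it cannot be an induced path. *)
Lemma near_adj (G : sgraph) (u x y : G) : p4_free G -> near u x -> adj x y -> near u y.
Proof.
move=> hG /existsP[w /andP[uw wx]] xy.
have nearx : eadj u x -> near u y.
  by move=> ux; apply/existsP; exists x; rewrite ux /eadj xy orbT.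
case/orP: uw => [/eqP uw|uw]; first by rewrite -uw in wx; apply: nearx.
case/orP: wx => [/eqP wx|wx]; first by rewrite wx in uw; apply: nearx; rewrite /eadj uw orbT.
have [ux|ux] := eqVneq u x; first by apply: nearx; rewrite /eadj ux eqxx.
have [ux'|nux] := boolP (adj u x); first by apply: nearx; rewrite /eadj ux' orbT.
have [wy|wy] := eqVneq w y.
  by apply/existsP; exists y; rewrite /eadj eqxx -wy uw orbT.
have [wy'|nwy] := boolP (adj w y); first by apply/existsP; exists w; rewrite /eadj uw wy' !orbT.
by apply/existsP; exists y; rewrite /eadj eqxx (hG u w x y) ?orbT.
Qed.

(** Adjacent vertices have the same set of vertices within distance two, by [near_adj]. As [pick]
    depends only on that set, they receive the same base point. *)
Lemma p4_free_contraction (G : sgraph) : p4_free G -> inhabited (contraction G).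
Proof.
move=> hG; have near_refl (v : G) : near v v by apply/existsP; exists v; rewrite /eadj eqxx.
pose r (v : G) := odflt v [pick u | near u v].
have near_r v : near (r v) v.
  by rewrite /r; case: pickP => [//|/(_ v)]; rewrite near_refl.
pose m (v : G) := odflt v [pick w | eadj (r v) w && eadj w v].
have mP v : eadj (r v) (m v) && eadj (m v) v.
  rewrite /m; case: pickP => [//|h]; case/existsP: (near_r v) => w.
  by rewrite h.
split; exists r m => [v|v|u v uv]; [by case/andP: (mP v) | by case/andP: (mP v) |].
have e : [pred w | near w u] =1 [pred w | near w v].
  move=> w; apply/idP/idP => /= h; first exact: near_adj h uv.
  by apply: near_adj h _ => //; rewrite adj_sym.
rewrite /r (eq_pick e); case: pickP => [//|/(_ v)] /=.
by rewrite near_refl.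
Qed.

Definition subgraph (G : sgraph) (p : pred G) : sgraph :=
  @SGraph {x : G | p x} (fun x y => adj (val x) (val y))
    (fun x y => adj_sym (val x) (val y)) (fun x => adj_irr (val x)).

Lemma graph_iso_split (G : sgraph) (p : pred G) :
  graph_iso (disjoint_union (subgraph p) (subgraph (predC p))) G \/
  exists x y, [/\ p x, ~~ p y & adj x y].
Proof.
have [/existsP[x /existsP[y /and3P[px py xy]]]|h] :=
  boolP [exists x, exists y, [&& p x, ~~ p y & adj x y]].
  by right; exists x, y.
have nadj x y : p x -> ~~ p y -> adj x y = false.
  move=> px py; apply: contraNF h => xy.
  by apply/existsP; exists x; apply/existsP; exists y; rewrite px py.
left; pose f (z : disjoint_union (subgraph p) (subgraph (predC p))) : G :=
  match z with inl x => val x | inr x => val x end.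
exists f; last first.
  case=> x [] y //=; first by rewrite (nadj _ _ (valP x) (valP y)).
  by rewrite adj_sym (nadj _ _ (valP y) (valP x)).
have f_inj : injective f.
  case=> [x|x] [y|y] /=.
  - by move=> /val_inj->.
  - by move=> xy; have /= := valP y; rewrite -xy (valP x).
  - by move=> xy; have /= := valP x; rewrite xy (valP y).
  by move=> /val_inj->.
have f_surj z : exists y, f y == z.
  have [pz|pz] := boolP (p z); first by exists (inl (exist _ z pz)).
  by exists (inr (exist _ z (pz : predC p z))).
exists (fun z => xchoose (f_surj z)) => z; last exact/eqP/(xchooseP (f_surj z)).
exact/f_inj/eqP/(xchooseP (f_surj (f z))).
Qed.

(** Induction on the construction of [G]. The vertex [x0] is there because the empty graph is not a
    cograph. *)
Lemma cograph_induced G : cograph G -> forall (H : sgraph) (f : H -> G) (x0 : H),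
  injective f -> (forall x y, adj (f x) (f y) = adj x y) -> cograph H.
Proof.
elim=> {G} [|G1 G2 _ IH1 _ IH2|G _ IHG|G G' [f [g fK gK] fadj] _ IHG] H h x0 h_inj hadj.
- apply: (cograph_iso _ cograph_point).
  have Hx0 x : x = x0 by apply: h_inj; case: (h x) (h x0) => [] [].
  exists (fun _ : unit => x0); last by move=> x y; rewrite adj_irr; case: x y => [] [].
  by exists (fun _ => tt) => [[]|x] //; rewrite [x]Hx0.
- pose p x := if h x is inl _ then true else false.
  case: (graph_iso_split p) => [iso|[x [y []]]]; last first.
    by rewrite /p -hadj; case: (h x) (h y) => [a|a] [b|b].
  (* If one side of the union misses [H], then [H] embeds in the other summand; otherwise [H] is the
     disjoint union of two nonempty parts. *)
  have [/forallP pT|] := boolP [forall x, p x].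
    have [a0 ha0] : exists a, h x0 = inl a.
      by have := pT x0; rewrite /p; case: (h x0) => // a; exists a.
    have hE x : h x = inl (if h x is inl a then a else a0) by have := pT x; rewrite /p; case: (h x).
    apply: (IH1 _ (fun x => if h x is inl a then a else a0) x0) => [x y xy|x y].
      by apply: h_inj; rewrite hE xy -hE.
    by rewrite -hadj [in RHS]hE [h y in RHS]hE.
  rewrite negb_forall => /existsP[x1 px1].
  have [/existsP[x2 px2]|] := boolP [exists x, p x]; last first.
    rewrite negb_exists => /forallP pF.
    have [a0 ha0] : exists a, h x0 = inr a.
      by have := pF x0; rewrite /p; case: (h x0) => // a; exists a.
    have hE x : h x = inr (if h x is inr a then a else a0) by have := pF x; rewrite /p; case: (h x).
    apply: (IH2 _ (fun x => if h x is inr a then a else a0) x0) => [x y xy|x y].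
      by apply: h_inj; rewrite hE xy -hE.
    by rewrite -hadj [in RHS]hE [h y in RHS]hE.
  apply: (cograph_iso iso); apply: cograph_union.
    have [a0 _] : exists a, h x2 = inl a by move: px2; rewrite /p; case: (h x2) => // a; exists a.
    have hE (x : subgraph p) : h (val x) = inl (if h (val x) is inl a then a else a0).
      by have := valP x; rewrite /= /p; case: (h _).
    apply: (IH1 _ (fun x : subgraph p => if h (val x) is inl a then a else a0)
      (exist _ x2 px2)) => [x y xy|x y].
      by apply/val_inj/h_inj; rewrite hE xy -hE.
    by rewrite -[RHS]hadj [in RHS]hE [h (val y) in RHS]hE.
  have [a0 _] : exists a, h x1 = inr a by move: px1; rewrite /p; case: (h x1) => // a; exists a.
  have hE (x : subgraph (predC p)) : h (val x) = inr (if h (val x) is inr a then a else a0).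
    by have := valP x; rewrite /= /p; case: (h _).
  apply: (IH2 _ (fun x : subgraph (predC p) => if h (val x) is inr a then a else a0)
    (exist _ x1 px1)) => [x y xy|x y].
    by apply/val_inj/h_inj; rewrite hE xy -hE.
  by rewrite -[RHS]hadj [in RHS]hE [h (val y) in RHS]hE.
(* The induction hypothesis applies to the complement of [H], and a double complement gives [H]
   back. *)
- suff : cograph (edge_complement (edge_complement H)).
    apply: cograph_iso; exists id; first by exists id.
    move=> x y; rewrite /= /compl_adj /= /compl_adj.
    by case: eqVneq => [->|_] /=; rewrite ?adj_irr ?negbK.
  apply/cograph_compl/(IHG (edge_complement H) h x0 h_inj) => x y.
  rewrite /= /compl_adj -hadj /= /compl_adj (inj_eq h_inj).
  by case: eqVneq => [->|_] /=; rewrite ?adj_irr ?negbK.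
apply: (IHG _ (g \o h) x0) => [x y /(can_inj gK)/h_inj|x y] //.
by rewrite -fadj /= !gK hadj.
Qed.

End Cographs.

(** * Generators and torsion *)

Lemma push_chain_linear (R : comNzRingType) (P Q : pgraph) (f : full_embedding P Q) n :
  linear (@push_chain R P Q f n).
Proof.
move=> a x y; apply/ffunP=> t; rewrite !ffunE scaler_sumr -big_split /=.
by apply: eq_bigr => s _; rewrite !ffunE.
Qed.

HB.instance Definition _ (R : comNzRingType) (P Q : pgraph) (f : full_embedding P Q) n :=
  GRing.isLinear.Build R _ _ _ (@push_chain R P Q f n) (@push_chain_linear R P Q f n).

Definition push_map (R : comNzRingType) (P Q : pgraph) (f : full_embedding P Q) n :
    chain_map R n P Q :=
  ChainMap (@push_chain_chain R P Q f n) (fun p c _ => @boundary_push R P Q f n c).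

Lemma homology_push_hmap (R : comNzRingType) (P Q : pgraph) (f : full_embedding P Q) n p
    (x : homology R P n p) : homology_push f x = hmap (push_map R f n) x.
Proof. by congr hclass; apply: val_inj. Qed.

Lemma covered_simplex (P Q : pgraph) (f : full_embedding P Q) (W : {set Q}) t :
    (forall w, w \in W -> exists i, f i = w) -> ends t \subset W ->
  exists u, t = push_simplex f u.
Proof.
move=> fW; case: t => [v|[[u v] uv]] /=.
  by rewrite finset.sub1set => /fW[i <-]; exists (inl i).
rewrite finset.subUset !finset.sub1set => /andP[/fW[i iu] /fW[j jv]].
have ij : adj i j by rewrite -(emb_adj f) iu jv.
by exists (inr (exist _ (i, j) ij)); congr inr; apply: val_inj; rewrite /= iu jv.
Qed.

Lemma piece_push (R : comNzRingType) (P Q : pgraph) (f : full_embedding P Q)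
    (d : contraction Q) n p (w : {ffun 'I_n -> osimplex Q}) :
    (forall v, v \in support_set d w -> exists i, f i = v) ->
  exists T : chain_map R n Q P, forall x : homology R Q n p,
    hmap (tens_map (fun _ => id) (fun j => piece_factor R d (w j))) x =
    homology_push f (hmap T x).
Proof.
move=> fW; have supp j s t : piece R d (w j) s t != 0 -> exists u, t = push_simplex f u.
  move=> /piece_support h; apply: covered_simplex fW _; apply: fintype.subset_trans h _.
  by apply: finset.setUS; apply: (finset.bigcup_sup j).
have hG j := restrict_factor (piece_factor R d (w j)) (supp j).
exists (tens_map (@emb_mem _ _ f) hG) => x.
by apply/esym/homology_push_restrict => j s t; apply: supp.
Qed.

(** The list consists of all codes of graphs on at most [N] vertices that are cographs with [r]
    pointed vertices. *)
Lemma bounded_cographs r N : exists (l : nat) (P : 'I_l -> pgraph),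
  (forall j, cograph (P j) /\ #|pts (P j)| = r) /\
  forall (Q : pgraph) (W : {set Q}), cograph Q -> #|pts Q| = r -> pts Q \subset W ->
    W != finset.set0 -> (#|W| <= N)%N ->
    exists j (f : full_embedding (P j) Q), forall w, w \in W -> exists i, f i = w.
Proof.
pose code := {m : 'I_N.+1 & ({ffun 'I_m * 'I_m -> bool} * {set 'I_m})%type}.
pose pg (c : code) := coded_pgraph (tagged c).1 (tagged c).2.
pose valid := [pred c : code | `[< cograph (pg c) /\ #|pts (pg c)| = r >]].
exists #|valid|, (fun j => pg (enum_val j)); split=> [j|Q W cogQ Qr QW W0 WN].
  by have /asboolP := enum_valP j.
have [a [K [f fW]]] := induced_coded QW.
have WN1 : (#|W| < N.+1)%N by [].
pose c : code := existT _ (Ordinal WN1) (a, K).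
have cv : c \in valid.
  apply/asboolP; split; last by rewrite -Qr -(card_pts_emb f).
  have /set0Pn[w wW] := W0; have [i _] := fW w wW.
  exact: (cograph_induced cogQ (f := f) i (@emb_inj _ _ f) (@emb_adj _ _ f)).
exists (enum_rank_in cv c); rewrite enum_rankK_in //; by exists f.
Qed.

(** * Bounded torsion in quotients of free abelian groups *)

Section Saturation.
Variable X : finType.
Implicit Types (L : {ffun X -> int} -> Prop) (z : {ffun X -> int}).

Lemma subgroup_add L x y : is_subgroup L -> L x -> L y -> L (x + y).
Proof.
by case=> L0 LB Lx Ly; rewrite -[y]opprK; apply: (LB) => //; rewrite -sub0r; apply: LB.
Qed.

Lemma subgroup_muln L x k : is_subgroup L -> L x -> L (x *+ k).
Proof.
move=> hL Lx; elim: k => [|k IHk]; first by rewrite mulr0n; case: hL.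
by rewrite mulrS; apply: subgroup_add.
Qed.

Lemma subgroup_mulz L x (k : int) : is_subgroup L -> L x -> L (x *~ k).
Proof.
move=> hL Lx; case: k => k; first exact: subgroup_muln.
by rewrite NegzE mulrNz -sub0r; case: (hL) => L0 LB; apply: LB => //; apply: subgroup_muln.
Qed.

(** Elimination of one coordinate at a time: an element of [L] with a positive entry [a] at [x]
    serves as pivot, and the exponent is the product of the pivots. *)
Lemma saturation L : is_subgroup L ->
  exists2 e, (0 < e)%N & forall z N, (0 < N)%N -> L (z *+ N) -> L (z *+ e).
Proof.
suff main (s : seq X) : forall L, is_subgroup L ->
    (forall z, L z -> forall x, x \notin s -> z x = 0) ->
    exists2 e, (0 < e)%N & forall z N, (0 < N)%N -> L (z *+ N) -> L (z *+ e).
  by move=> hL; apply: (main (enum X)) => // z _ x; rewrite mem_enum.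
have ffMn z k x : (z *+ k) x = z x *+ k by elim: k => [|k IHk]; rewrite ?mulrS ffunE ?IHk.
have ffMz z (k : int) x : (z *~ k) x = z x *~ k.
  by case: k => k; rewrite ?NegzE ?mulrNz ?ffunE -!pmulrn ffMn.
elim: s => [|x s IHs] {}L hL suppL.
  exists 1%N => // z N N0 LzN; suff -> : z = 0 by rewrite mul0rn; case: hL.
  apply/ffunP=> x; rewrite ffunE; have /eqP := suppL _ LzN x isT.
  by rewrite ffMn Num.Theory.mulrn_eq0 (gtn_eqF N0) => /eqP.
have [[g Lg gx]|h] := pselect (exists2 g, L g & g x != 0); last first.
  apply: IHs hL _ => z Lz y ys; have [->|yx] := eqVneq y x.
    by apply/eqP; apply: contra_notT h => zx; exists z.
  by apply: suppL; rewrite // inE negb_or yx.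
have [a a0 [g' Lg' ga]] : exists2 a, (0 < a)%N & exists2 g', L g' & g' x = a%:Z.
  case gE: (g x) => [a|a].
    exists a; last by exists g.
    by rewrite lt0n; apply: contraNneq gx => a0; rewrite gE a0.
  exists a.+1 => //; exists (0 - g); first by case: hL => L0 LB; apply: LB.
  by rewrite !ffunE gE NegzE opprK add0r.
pose L' z := L z /\ z x = 0.
have [] := IHs L'.
- case: (hL) => L0 LB; split; first by rewrite /L' ffunE.
  by move=> y z [Ly yx] [Lz zx]; split; [apply: LB | rewrite !ffunE yx zx subr0].
- move=> z [Lz zx] y ys; have [->//|yx] := eqVneq y x.
  by apply: suppL; rewrite // inE negb_or yx.
move=> e' e'0 satL'; exists (a * e')%N => [|z N N0 LzN]; first by rewrite muln_gt0 a0.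
(* The multiple of the pivot is chosen so that [u] vanishes at [x], which puts its multiples in [L]
   under the induction hypothesis. *)
pose u := z *+ a - g' *~ (z x).
have ux : u x = 0 by rewrite !ffunE ffMn ffMz ga mulrzz -mulr_natr natz mulrC subrr.
have LuN : L' (u *+ N).
  split; last by rewrite ffMn ux mul0rn.
  rewrite mulrnBl -mulrnA mulnC mulrnA; case: (hL) => L0 LB; apply: LB.
    exact: subgroup_muln.
  by apply: subgroup_muln => //; apply: subgroup_mulz.
have [Lue _] := satL' _ _ N0 LuN.
have -> : z *+ (a * e') = u *+ e' + g' *~ (z x) *+ e'.
  by rewrite -mulrnDl subrK mulrnA.
apply: subgroup_add => //; apply: subgroup_muln => //; exact: subgroup_mulz.
Qed.

End Saturation.

(** A multiple of a class vanishes exactly when that multiple of a representing cycle is a boundary,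
    so [saturation] applies to the group of boundaries. *)
Lemma homology_torsion_bound (P : pgraph) n p :
  exists2 e, (0 < e)%N & forall (x : homology int P n p) N,
    (0 < N)%N -> x *+ N = 0 -> x *+ e = 0.
Proof.
pose L (c : {ffun cube P n -> int}) := exists2 b : {ffun cube P n -> int^o},
  b \in chain p.+1 & c = boundary b.
have [c0 cD] := chain_submod int P n p.+1.
have hL : is_subgroup L.
  split; first by exists 0 => //; rewrite linear0.
  move=> x y [b bc ->] [d dc ->]; exists (-1 *: d + b); first exact: cD.
  by rewrite linearP /= scaleN1r addrC.
have [e e0 satL] := saturation hL; exists e => // x N N0.
have LE k : (x *+ k = 0) <-> L (cycle_val (hrepr x) *+ k).
  rewrite -[x in x *+ k]hreprK -raddfMn -(raddf0 (@hclass int P n p)).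
  have valMn (z : Defs.cycle int P n p) : cycle_val (z *+ k) = cycle_val z *+ k.
    by elim: k => // k IHk; rewrite !mulrS -IHk.
  rewrite -valMn; split.
    by move=> /eqP; rewrite hclass_eq subr0 => /asboolP.
  by move=> h; apply/eqP; rewrite hclass_eq subr0; apply/asboolP.
by move=> /LE h; apply/LE; apply: satL N0 h.
Qed.

Lemma exponent_dvd (A : zmodType) (S : set A) d :
  (0 < d)%N -> (forall x, S x -> x *+ d = 0) -> (exponent S %| d)%N.
Proof.
move=> d0 hd; rewrite /exponent; case: pselect => [h|[]]; last first.
  by exists d; apply/asboolP.
case: ex_minnP => N /asboolP[N0 hN] Nmin; apply/eqP/eqP; rewrite -leqn0 leqNgt.
apply/negP=> r0; suff: (N <= d %% N)%N by rewrite leqNgt ltn_pmod.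
apply: Nmin; apply/asboolP; split=> // x Sx; have := hd x Sx.
by rewrite {1}(divn_eq d N) mulrnDr mulnC mulrnA hN // mul0rn add0r.
Qed.

Section FiniteGeneration.
Variables i r n : nat.

(** The list is chosen before the ring and the graph. Recording a factorisation of each summand, and
    not just generation, lets torsion be bounded on the listed graphs. *)
Lemma cograph_generators : exists (l : nat) (P : 'I_l -> pgraph),
  (forall j, cograph (P j) /\ #|pts (P j)| = r) /\
  forall (R : comNzRingType) (Q : pgraph), cograph Q -> #|pts Q| = r ->
    exists (I : finType) (F : I -> chain_map R n Q Q),
      (forall x : homology R Q n i, x = \sum_a hmap (F a) x) /\
      forall a, exists j (f : full_embedding (P j) Q) (T : chain_map R n Q (P j)),
        forall x : homology R Q n i, hmap (F a) x = homology_push f (hmap T x).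
Proof.
(* The support of a word has at most 3r + 6n vertices; one more vertex keeps the set nonempty when
   [r] and [n] are both zero. *)
have [l [P [hP PW]]] := bounded_cographs r (r * 3 + n * 6).+1.
exists l, P; split=> // R Q cogQ Qr.
have [d] := p4_free_contraction (cograph_p4_free cogQ).
have [x0 _] := cograph_inhabited cogQ.
exists {ffun 'I_n -> osimplex Q},
  (fun w : {ffun 'I_n -> osimplex Q} => tens_map (fun _ => id) (fun j => piece_factor R d (w j))).
split=> [x|w]; first exact: homology_decomposition.
have [] := PW Q (x0 |: support_set d w) cogQ Qr.
- apply/fintype.subsetP=> k kQ; rewrite !inE; apply/orP; right; apply/orP; left.
  by apply/bigcupP; exists k; rewrite // !inE eqxx orbT.
- by apply/set0Pn; exists x0; rewrite !inE eqxx.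
- rewrite cardsU1; apply: (leq_add (leq_b1 _)).
  by rewrite -Qr; apply: card_support_set.
move=> j [f fW]; have [|T hT] := @piece_push R _ _ f d n i w.
  by move=> v vW; apply: fW; rewrite inE vW orbT.
by exists j, f, T.
Qed.

End FiniteGeneration.

Lemma homology_generation i r n : exists (l : nat) (P : 'I_l -> pgraph),
  (forall j : 'I_l, cograph (P j) /\ #|pts (P j)| = r) /\
  (forall Q : pgraph, cograph Q -> #|pts Q| = r ->
     subgroup_generated
       [set y : homology int Q n i |
          exists (j : 'I_l) (f : full_embedding (P j) Q)
                 (x : homology int (P j) n i), y = homology_push f x]%classic
     = [set: homology int Q n i]%classic).
Proof.
have [l [P [hP gen]]] := cograph_generators i r n; exists l, P; split=> // Q cogQ Qr.
have [I [F [Fsum FP]]] := gen int Q cogQ Qr.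
apply/seteqP; split=> // x _ B [[B0 BB] SB]; rewrite (Fsum x).
elim/big_rec: _ => [//|a y _ By]; rewrite addrC -[hmap _ _]opprK.
have Ba : B (hmap (F a) x).
  by apply: SB; have [j [f [T hT]]] := FP a; exists j, f, (hmap T x).
by apply: (BB) => //; rewrite -sub0r; apply: BB.
Qed.

(** A torsion class is a sum of images of torsion classes of listed graphs, so the product of the
    exponents of those graphs annihilates it. *)
Lemma torsion_exponent_bound i r n : exists d : nat, (1 <= d)%N /\
  (forall Q : pgraph, cograph Q -> #|pts Q| = r ->
     exponent (@torsion (homology int Q n i)) %| d)%N.
Proof.
have [l [P [hP gen]]] := cograph_generators i r n.
have eP j : {e | (0 < e)%N & forall (x : homology int (P j) n i) N,
    (0 < N)%N -> x *+ N = 0 -> x *+ e = 0}.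
  by apply: cid2; apply: homology_torsion_bound.
pose e j := s2val (eP j); exists (\prod_j e j)%N.
have d0 : (0 < \prod_j e j)%N by rewrite prodn_gt0 // => j; apply: (s2valP (eP j)).
split=> // Q cogQ Qr; apply: exponent_dvd => // x [N N0 xN].
have [I [F [Fsum FP]]] := gen int Q cogQ Qr.
rewrite (Fsum x) -sumrMnl big1 // => a _; have [j [f [T hT]]] := FP a.
have Tx : hmap T x *+ e j = 0.
  by apply: (s2valP' (eP j) _ N) => //; rewrite -raddfMn xN raddf0.
rewrite hT homology_push_hmap -raddfMn (bigD1 j) //=.
by rewrite mulrnA Tx mul0rn raddf0.
Qed.

(** * Linear algebra *)

Section LinearAlgebra.
Variable k : fieldType.

Lemma linear_mulmx m n (f : 'rV[k]_m -> 'rV[k]_n) : linear f ->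
  exists M, forall u, f u = u *m M.
Proof.
move=> lf; pose F : {linear 'rV[k]_m -> 'rV[k]_n} :=
  HB.pack f (GRing.isLinear.Build k _ _ _ f lf).
by exists (lin1_mx F) => u; rewrite mul_rV_lin1.
Qed.

Lemma linear_injective_leq m n (f : 'rV[k]_m -> 'rV[k]_n) :
  linear f -> injective f -> (m <= n)%N.
Proof.
move=> lf f_inj; have [M fM] := linear_mulmx lf.
have : row_free M.
  apply: inj_row_free => v vM; apply: f_inj.
  by rewrite !fM vM mul0mx.
by rewrite /row_free => /eqP <-; apply: rank_leq_col.
Qed.

(** An injective linear map from the largest possible row space is onto, since a vector outside its
    image would allow a larger one. *)
Lemma bounded_has_dimension (V : lmodType k) N :
    (forall d (f : 'rV[k]_d -> V), linear f -> injective f -> (d <= N)%N) ->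
  exists d, has_dimension V d.
Proof.
move=> hN; pose emb d := `[< exists2 f : 'rV[k]_d -> V, linear f & injective f >].
have emb0 : exists d, emb d.
  exists 0%N; apply/asboolP; exists (fun _ => 0) => [a u v|u v _].
    by rewrite scaler0 addr0.
  by rewrite [u]thinmx0 [v]thinmx0.
have embN d : emb d -> (d <= N)%N by case/asboolP=> f lf f_inj; apply: hN f_inj.
case: (ex_maxnP emb0 embN) => d /asboolP[f lf f_inj] dmax.
pose F : {linear 'rV[k]_d -> V} := HB.pack f (GRing.isLinear.Build k _ _ _ f lf).
have f_surj v : exists u, f u = v.
  apply: contrapT => vf; suff : emb (d + 1)%N by move/dmax; rewrite addn1 ltnn.
  pose g (u : 'rV[k]_(d + 1)) := f (lsubmx u) + (rsubmx u) 0 0 *: v.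
  have lg : linear g.
    move=> a x y; rewrite /g !linearP lf !mxE scalerDl -!scalerA scalerDr.
    by rewrite addrACA.
  apply/asboolP; exists g => // x y gxy.
  pose G : {linear 'rV[k]_(d + 1) -> V} := HB.pack g (GRing.isLinear.Build k _ _ _ g lg).
  have : G (x - y) = 0 by rewrite linearB /= gxy subrr.
  rewrite /= /g; set z := x - y; have [z0|z0] := eqVneq ((rsubmx z) 0 0) 0.
    rewrite z0 scale0r addr0 => fz.
    have lz : lsubmx z = 0 by apply: f_inj; rewrite fz -[f 0]/(F 0) linear0.
    apply/eqP; rewrite -subr_eq0 -/z -[z]hsubmxK lz.
    by rewrite [rsubmx z]mx11_scalar z0 raddf0 row_mx0.
  move/eqP; rewrite addrC addr_eq0 => /eqP zv; case: vf.
  exists (- ((rsubmx z 0 0)^-1 *: lsubmx z)).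
  rewrite -[LHS]/(F _) linearN linearZ /= -scalerN -zv scalerA mulVf ?scale1r //.
exists d; split; pose g v := sval (cid (f_surj v)).
have gK v : f (g v) = v by apply: (svalP (cid (f_surj v))).
exists g; last by exists f => [v|u]; [apply: gK | apply: f_inj; rewrite gK].
by move=> a x y; apply: f_inj; rewrite lf !gK.
Qed.

(** Multiplying the sum by one term shows that each [M a] is idempotent. The row spaces are then
    independent and together span everything. *)
Lemma orthogonal_idempotents_rank D (I : finType) (M : I -> 'M[k]_D) :
    \sum_a M a = 1%:M -> (forall a b, a != b -> M a *m M b = 0) ->
  D = (\sum_a \rank (M a))%N.
Proof.
move=> M1 M0; have MM a : M a *m M a = M a.
  rewrite -[RHS]mulmx1 -M1 mulmx_sumr (bigD1 a) //= big1 ?addr0 // => b.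
  by rewrite eq_sym => /M0.
have dir : mxdirect (\sum_a <<M a>>)%MS.
  apply/mxdirect_sumsP => a _; apply/eqP.
  set X := (_ :&: _)%MS.
  have XMa : X *m M a = X.
    have /submxP[Y ->] : (X <= M a)%MS by rewrite -(genmxE (M a)) capmxSl.
    by rewrite -mulmxA MM.
  rewrite -XMa -sub_kermx.
  apply: submx_trans (capmxSr _ _) _; apply/sumsmx_subP => b ba.
  by rewrite genmxE sub_kermx M0.
have full : (1%:M <= \sum_a <<M a>>)%MS.
  rewrite -M1; apply: summx_sub => a _.
  by rewrite (sumsmx_sup a) // genmxE.
have := mxrankS full; rewrite mxrank1 => le1.
rewrite -[LHS](_ : \rank (\sum_a <<M a>>)%MS = D); last first.
  by apply/eqP; rewrite eqn_leq le1 rank_leq_row.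
rewrite (mxdirectP dir) /=; apply: eq_bigr => a _.
by rewrite genmxE.
Qed.

(** An idempotent [A *m B] equals A (B A) B, so its rank is at most that of [B *m A]; the situation
    is symmetric. *)
Lemma rank_idempotent_conj m n (A : 'M[k]_(m, n)) (B : 'M[k]_(n, m)) :
    A *m B *m (A *m B) = A *m B -> B *m A *m (B *m A) = B *m A ->
  \rank (A *m B) = \rank (B *m A).
Proof.
have le p q (C : 'M[k]_(p, q)) (E : 'M[k]_(q, p)) : C *m E *m (C *m E) = C *m E ->
    (\rank (C *m E) <= \rank (E *m C))%N.
  move=> h; rewrite -h mulmxA -[C *m E *m C]mulmxA.
  by apply: leq_trans (mxrankM_maxl _ _) (mxrankM_maxr _ _).
by move=> h1 h2; apply/eqP; rewrite eqn_leq !le.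
Qed.

End LinearAlgebra.

Section HomologyDimension.
Variables (k : fieldType) (P : pgraph) (n p : nat).

(** Lifting a basis to representing cycles embeds any row space contained in the homology into the
    functions on cubes, which bounds its size. *)
Lemma homology_has_dimension : exists d, has_dimension (homology k P n p) d.
Proof.
apply: (@bounded_has_dimension _ _ #|cube P n|) => d f lf f_inj.
pose z i : Defs.cycle k P n p := hrepr (f (delta_mx 0 i)).
pose lift (u : 'rV[k]_d) : Defs.cycle k P n p := \sum_i u 0 i *: z i.
pose coord (c : Defs.cycle k P n p) : 'rV[k]_#|cube P n| :=
  \row_j cycle_val c (enum_val j).
have l_lift : linear lift.
  move=> a u v; rewrite /lift scaler_sumr -big_split; apply: eq_bigr => i _ /=.
  by rewrite !mxE scalerDl scalerA.
have coordD a c c' : coord (a *: c + c') = a *: coord c + coord c'.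
  by apply/rowP=> j; rewrite !mxE /= !ffunE.
apply: (@linear_injective_leq k _ _ (coord \o lift)) => [a u v|u v /rowP uv] /=.
  by rewrite l_lift coordD.
apply: f_inj; pose F : {linear 'rV[k]_d -> homology k P n p} :=
  HB.pack f (GRing.isLinear.Build k _ _ _ f lf).
have fE w : f w = hclass (lift w).
  rewrite {1}[w]row_sum_delta -[LHS]/(F _) linear_sum raddf_sum; apply: eq_bigr => i _.
  by rewrite linearZ /= -hscaleE /z hreprK.
rewrite !fE; congr hclass; apply: val_inj; apply/ffunP=> s.
by have := uv (enum_rank s); rewrite !mxE enum_rankK.
Qed.

End HomologyDimension.

(** * Complete graphs *)

Section CompleteGraphs.
Variables (r n : nat).

Notation K m := (complete_pgraph m.+1 r).

Lemma star_mid_end m (v : K m) : eadj (ord0 : K m) v.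
Proof. by rewrite /eadj /= orbN. Qed.

Definition star m : contraction (K m) :=
  @Contraction (K m) (fun _ => ord0) (fun _ => ord0)
    (fun _ => star_mid_end ord0) (@star_mid_end m) (fun _ _ _ => erefl).

(* The pieces of the decomposition that do not vanish for the star at [ord0]. *)
Definition good m (a : osimplex (K m)) : bool :=
  match a with
  | inl v => v == ord0
  | inr e => [&& positive (inr e : osimplex (K m)), (val e).1 != ord0 & (val e).2 != ord0]
  end.

Section Ring.
Variable R : comNzRingType.

(** These behave like matrix units between pieces of two complete graphs, and are zero between a
    vertex and an edge. Pointed vertices are matched by their index through [inord]. *)
Definition matrix_unit m m' (a : osimplex (K m)) (b : osimplex (K m')) :
    osimplex (K m) -> osimplex (K m') -> R :=
  match a, b with
  | inl _, inl _ => vertex_piece R (star m) (star m') (fun v => inord v) ord0 ord0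
  | inr e, inr f => loop_piece R (star m') e f
  | _, _ => fun _ _ => 0
  end.

Lemma inord_pts m m' (v : K m) : (r <= m'.+1)%N -> v \in pts (K m) ->
  (inord v : K m') \in pts (K m') /\ (inord (inord v : K m') : K m) = v.
Proof.
rewrite !inE => rm vr; have vm' : (v < m'.+1)%N := leq_trans vr rm.
by rewrite inordK // inord_val.
Qed.

Lemma matrix_unit_factor m m' a b : (r <= m.+1)%N ->
  factor_map (fun v : K m' => inord (v : 'I_m'.+1) : K m) (@matrix_unit m m' a b).
Proof.
move=> rm; case: a b => [v|e] [w|f]; try exact: factor_map0.
  by apply: vertex_piece_factor => // x xm'; apply: inord_pts.
exact: loop_piece_factor.
Qed.

Lemma arc_chain_diag (G : sgraph) (u : G) s : arc_chain R u u s = 0.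
Proof. by case: s => //= e; rewrite subrr. Qed.

Lemma star_path m (v : K m) s : path_chain R (star m) v s = arc_chain R (ord0 : K m) v s.
Proof. by rewrite /path_chain /= arc_chain_diag add0r. Qed.

Lemma star_path0 m s : path_chain R (star m) ord0 s = 0.
Proof. by rewrite star_path arc_chain_diag. Qed.

Lemma piece_good m a s t : good a -> piece R (star m) a s t = matrix_unit a a s t.
Proof.
case: a => [v /eqP->|e /=]; last by case/and3P=> ->.
by case: s => [v'|e] /=; rewrite inord_val.
Qed.

(** Every vertex has base point [ord0], so other vertex pieces are zero; the loop of an edge at
    [ord0] runs along the edge and straight back. *)
Lemma piece_bad m a s t : ~~ good a -> piece R (star m) a s t = 0.
Proof.
case: a => [v|e] /=.
  by rewrite eq_sym => /negPf v0; case: s => [v'|e] /=; rewrite v0 // mul0r.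
case: ifP => //= _; rewrite negb_and !negbK /loop_piece /loop.
case/orP=> /eqP->; rewrite star_path0.
  by rewrite star_path addr0 subrr mulr0.
by rewrite star_path subr0 (arcC R (ord0 : K m)) addNr mulr0.
Qed.

Lemma path_good m (v : K m) e : good (inr e) -> path_chain R (star m) v (inr e) = 0.
Proof.
case: e => [[x y] xy] /and3P[_ /= x0 y0]; rewrite star_path /= !xpair_eqE.
by rewrite (negPf x0) (negPf y0) !andbF subrr.
Qed.

(** The paths of the star contain no good edge, so a loop meets the good edges only in its own edge,
    and positivity excludes the reversed orientation. *)
Lemma loop_good m (e f : {e : K m * K m | adj e.1 e.2}) : good (inr e) -> good (inr f) ->
  loop R (star m) (val e).1 (val e).2 (inr f) = (e == f)%:R.
Proof.
move=> ge gf; rewrite /loop !path_good // subr0 addr0 arcE.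
rewrite [X in _ - X](_ : _ = 0) ?subr0 //.
case: eqP => // ef; have /and3P[pe _ _] := ge; have /and3P[pf _ _] := gf.
by have := @positive_rev (K m) (inr e) isT; rewrite ef pf pe.
Qed.

Definition same_kind m m' (a : osimplex (K m)) (b : osimplex (K m')) : bool :=
  is_edge a == is_edge b.

(** The mixed products vanish for two reasons: a path of the star contains no good edge, and a loop
    is killed by any form depending only on targets. Two loop pieces compose by [loop_good], two
    vertex pieces by matching pointed indices. *)
Lemma matrix_unit_comp m m' m'' (a : osimplex (K m)) (b b' : osimplex (K m'))
    (c : osimplex (K m'')) s t :
    (r <= m'.+1)%N -> good b -> good b' -> same_kind a b -> same_kind b' c ->
  mcomp (matrix_unit a b) (matrix_unit b' c) s t = (b == b')%:R * matrix_unit a c s t.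
Proof.
move=> rm gb gb'; rewrite /mcomp.
pose gA (u : K m') : R := (u \in pts (K m'))%:R * path_chain R (star m'') (inord u) t.
have gAE e : @vertex_piece R (K m') (K m'') (star m') (star m'') (fun v => inord v)
    ord0 ord0 (inr e) t = gA (val e).2 by [].
case: a b gb b' gb' c => [v|e] [w|f] gb [w'|f'] gb' [x|h] // _ _.
- rewrite (eqP gb) (eqP gb') eqxx mul1r; case: s => [u|e] /=.
    rewrite (bigD1 (inl (if u \in pts (K m) then inord u else ord0))) //= eqxx mul1r.
    rewrite big1 ?addr0 => [|z /negPf->]; last by rewrite mul0r.
    congr ((_ == inl _) : bool)%:R; rewrite !inE.
    have [ur|ur] := boolP (u < r)%N; first by rewrite inordK ?ur // (leq_trans ur rm).
    by case: ifP => // _; apply: val_inj; rewrite /= inordK.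
  case eK: ((val e).2 \in pts (K m)); last first.
    by rewrite mulr0n mul0r big1 // => z _; rewrite !mul0r.
  rewrite mul1r; under eq_bigr do rewrite mul1r.
  rewrite (sum_path_chain (star m') _ gAE) /gA /=.
  rewrite (proj1 (inord_pts rm eK)) inordK; last by rewrite inE in eK; apply: leq_trans rm.
  have -> : (inord (ord0 : K m') : K m'') = ord0 by apply: val_inj; rewrite /= inordK.
  by rewrite star_path0 mulr0 subr0 mul1r.
- rewrite mul0r; case: s => [u|e] /=.
    by rewrite big1 // => -[z|z] _; rewrite /loop_piece /= ?andbF ?mul0r ?mulr0.
  rewrite big1 // => z _; rewrite /loop_piece; case: (z =P inr f') => [->|_].
    by rewrite path_good // mulr0 mul0r.
  by rewrite mul0r mulr0.
- rewrite mul0r /=; under eq_bigr do rewrite /loop_piece -mulrA.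
  by rewrite -mulr_sumr (sum_loop (star m') (valP f) gAE) mulr0.
rewrite /= /loop_piece (bigD1 (inr f')) //= eqxx mul1r big1 ?addr0 => [|z /negPf->].
  by rewrite loop_good // -mulrA [RHS]mulrCA.
by rewrite mul0r mulr0.
Qed.

Section Homology.
Variable p : nat.

Definition unit_map m m' (rm : (r <= m.+1)%N) (rm' : (r <= m'.+1)%N)
    (w : {ffun 'I_n -> osimplex (K m)}) (w' : {ffun 'I_n -> osimplex (K m')}) :
    chain_map R n (K m) (K m') :=
  tens_map (fun v vK => (inord_pts rm vK).1)
    (fun j => matrix_unit_factor (w j) (w' j) rm).

Lemma hmap_comp_eq0 (P Q S : pgraph) (T : chain_map R n P Q) (T' : chain_map R n Q S)
    (x : homology R P n p) : (forall c, T' (T c) = 0) -> hmap T' (hmap T x) = 0.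
Proof.
move=> T0; rewrite [hmap T x]/hmap hmapE -(raddf0 (@hclass R S n p)); congr hclass.
by apply: val_inj; apply: T0.
Qed.

Lemma tens_eq0 (G H : sgraph) (F : 'I_n -> osimplex G -> osimplex H -> R) j c :
  (forall s t, F j s t = 0) -> tens F c = 0.
Proof.
move=> F0; apply/ffunP=> t; rewrite !ffunE big1 // => s _.
by rewrite (bigD1 j) //= F0 !mul0r.
Qed.

Lemma unit_map_comp m m' m'' (rm : (r <= m.+1)%N) (rm' : (r <= m'.+1)%N)
    (rm'' : (r <= m''.+1)%N) (w : {ffun 'I_n -> osimplex (K m)})
    (u u' : {ffun 'I_n -> osimplex (K m')}) (w' : {ffun 'I_n -> osimplex (K m'')})
    (x : homology R (K m) n p) :
    (forall j, good (u j)) -> (forall j, good (u' j)) ->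
    (forall j, same_kind (w j) (u j)) -> (forall j, same_kind (u' j) (w' j)) ->
  hmap (unit_map rm' rm'' u' w') (hmap (unit_map rm rm' w u) x) =
  if u == u' then hmap (unit_map rm rm'' w w') x else 0.
Proof.
move=> gu gu' wu uw'.
have E j s t := @matrix_unit_comp m m' m'' (w j) (u j) (u' j) (w' j) s t rm'
  (gu j) (gu' j) (wu j) (uw' j).
case: eqP => [uu'|uu'].
  apply: hmap_comp => c _ /=; rewrite tens_comp; apply: eq_tens => j s t.
  by rewrite E uu' eqxx mul1r.
have /existsP[j uj] : [exists j, u j != u' j].
  by rewrite -negb_forall; apply: contra_notN uu' => /forallP h; apply/ffunP=> j; apply/eqP.
apply: hmap_comp_eq0 => c /=; rewrite tens_comp; apply: (tens_eq0 (j := j)) => s t.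
by rewrite E (negPf uj) mul0r.
Qed.

Lemma complete_decomposition m (rm : (r <= m.+1)%N) (x : homology R (K m) n p) :
  x = \sum_(w : {ffun 'I_n -> osimplex (K m)} | [forall j, good (w j)])
        hmap (unit_map rm rm w w) x.
Proof.
rewrite [LHS](homology_decomposition (star m)).
rewrite (bigID (fun w : {ffun 'I_n -> osimplex (K m)} => [forall j, good (w j)])) /=.
rewrite [X in _ + X]big1 ?addr0 => [|w]; last first.
  rewrite negb_forall => /existsP[j wj].
  rewrite -[X in hmap _ X]hreprK hmapE -(raddf0 (@hclass R (K m) n p)); congr hclass.
  by apply: val_inj; apply: (tens_eq0 (j := j)) => s t; apply: piece_bad.
apply: eq_bigr => w /forallP gw; apply: eq_hmap => c _ /=; apply: eq_tens => j s t.
exact: piece_good.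
Qed.

End Homology.
End Ring.

Definition edge_factors m (w : {ffun 'I_n -> osimplex (K m)}) : {set 'I_n} :=
  [set j | is_edge (w j)].

Definition good_edges m : nat := #|[pred e | @good m (inr e)]|.

(** Outside [A] the only good piece is the one at [ord0], so there is a choice only at the factors
    in [A]. *)
Lemma card_good_words m (A : {set 'I_n}) :
  (\sum_(w : {ffun 'I_n -> osimplex (K m)} | [forall j, good (w j)] && (edge_factors w == A)) 1
   = good_edges m ^ #|A|)%N.
Proof.
pose F (j : 'I_n) : pred (osimplex (K m)) := [pred a | good a && (is_edge a == (j \in A))].
transitivity (\sum_(w in family F) \prod_(j < n) 1)%N.
  apply: eq_big => [w|w _]; last by rewrite big1.
  apply/andP/familyP => [[/forallP gw /eqP wA] j|h].
    by rewrite !inE gw -wA inE eqxx.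
  split; first by apply/forallP=> j; have := h j; rewrite inE => /andP[].
  by apply/eqP/setP=> j; rewrite inE; have := h j; rewrite inE => /andP[_ /eqP].
rewrite -(bigA_distr_big_dep (fun j => [in F j]) (fun _ _ => 1%N)) /=.
transitivity (\prod_(j < n) (if j \in A then good_edges m else 1))%N; last first.
  by rewrite -big_mkcond /= prod_nat_const.
apply: eq_bigr => j _; rewrite sum1_card; case: ifP => jA.
  rewrite /good_edges -[RHS](card_image (@inr_inj (K m) _)); apply: eq_card => a.
  apply/idP/fintype.imageP => [|[e ge ->]]; last first.
    by apply/andP; split; [exact: ge | rewrite /= jA].
  rewrite !inE jA; case: a => [v|e] /andP[ga //] _; by exists e.
rewrite -(card1 (inl ord0 : osimplex (K m))); apply: eq_card => a; rewrite !inE jA.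
by case: a => [v|e] /=; rewrite ?andbT ?andbF.
Qed.

(** Swapping the ends matches the good edges with their reversals, and together they are the ordered
    pairs of distinct vertices among the [m] vertices other than [ord0]. *)
Lemma good_edges_double m : (good_edges m * 2 = m * m.-1)%N.
Proof.
pose B := [set e : K m * K m | [&& e.1 != ord0, e.2 != ord0 & e.1 != e.2]].
pose lt := [set e : K m * K m | (enum_rank e.1 < enum_rank e.2)%N].
have cardB : #|B| = (m * m.-1)%N.
  rewrite -sum1_card.
  transitivity (\sum_(u : K m | u != ord0) \sum_(v : K m | (v != ord0) && (u != v)) 1)%N.
    rewrite pair_big_dep; apply: eq_bigl => -[u v]; rewrite inE /=.
    by case: (u != ord0).
  transitivity (\sum_(u : K m | u != ord0) m.-1)%N; last first.
    by rewrite sum_nat_const; congr (_ * _)%N; rewrite (cardC1 (ord0 : 'I_m.+1)) card_ord.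
  apply: eq_bigr => u u0; rewrite sum1_card.
  have m0 : (0 < m)%N.
    by rewrite -ltnS (leq_trans _ (ltn_ord u)) // ltnS lt0n.
  have := cardC [set (ord0 : K m); u]; rewrite cards2 eq_sym u0 card_ord.
  have -> : #|[predC [set ord0; u]]| = #|[pred v : K m | (v != ord0) && (u != v)]|.
    by apply: eq_card => v; rewrite !inE negb_or [u == v]eq_sym.
  by move=> h; apply/eqP; rewrite -(eqn_add2l 2) h; case: (m) m0 => [|m'].
have goodE : good_edges m = #|B :&: lt|.
  rewrite /good_edges -[LHS](card_image val_inj); apply: eq_card => -[u v].
  apply/fintype.imageP/idP => [[e ge ->]|].
    move: ge; rewrite !inE /= => /and3P[-> -> ->]; rewrite andbT.
    exact: (valP e).
  rewrite !inE /= => /andP[/and3P[u0 v0 uv] ltuv].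
  by exists (exist _ (u, v) uv); rewrite ?inE /= ?ltuv ?u0 ?v0.
rewrite -cardB -(cardsID lt B) goodE muln2 -addnn; congr (_ + _)%N.
pose sw (e : K m * K m) := (e.2, e.1).
have swK : involutive sw by case.
rewrite -(card_imset _ (inv_inj swK)); apply: eq_card => e.
rewrite -{1}[e]swK (mem_imset _ _ (inv_inj swK)) !inE /= [_.2 == _.1]eq_sym.
case: (eqVneq e.1 e.2) => [|ne]; first by rewrite !andbF.
have -> : (enum_rank e.2 < enum_rank e.1)%N = ~~ (enum_rank e.1 < enum_rank e.2)%N.
  by rewrite -leqNgt [RHS]leq_eqVlt val_eqE (inj_eq enum_rank_inj) eq_sym (negPf ne).
by case: (e.1 != ord0); case: (e.2 != ord0); case: (_ < _)%N.
Qed.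

End CompleteGraphs.

Lemma operator_matrix (k : fieldType) (V V' : lmodType k) d d'
    (v : V -> 'rV[k]_d) (v' : V' -> 'rV[k]_d') (T : {linear V -> V'}) :
    linear v -> bijective v -> linear v' ->
  exists M, forall x, v' (T x) = v x *m M.
Proof.
move=> lv [u vK uK] lv'.
have lu : linear u by move=> a x y; apply: (can_inj vK); rewrite uK lv !uK.
have [a x y|M hM] := @linear_mulmx k _ _ (fun w => v' (T (u w))).
  by rewrite lu linearP lv'.
by exists M => x; rewrite -hM vK.
Qed.

(** * Dimension of the homology of complete graphs *)

Section CompletePolynomial.
Variables (i r n : nat) (k : fieldType).

Notation K m := (complete_pgraph m.+1 r).
Notation H m := (homology k (K m) n i).

(** The operators of good words are orthogonal idempotents with sum the identity, so their ranks add
    up to the dimension. Each rank is computed on one reference graph, which makes [D] independent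
    of [m]. *)
Lemma complete_dimension : exists D : {set 'I_n} -> nat, forall m, (r <= m.+1)%N ->
  has_dimension (H m) (\sum_(A : {set 'I_n}) good_edges r m ^ #|A| * D A)%N.
Proof.
have rm0 : (r <= r.+3)%N by rewrite -addn3 leq_addr.
(* The reference graph has [r.+3] vertices: enough for the [r] pointed ones, and at least three, so
   that a good edge exists. *)
pose m0 := r.+2; have [d0 [[v0 lv0 bv0]]] := homology_has_dimension k (K m0) n i.
have [e0 ge0] : exists e : {e : K m0 * K m0 | adj e.1 e.2}, @good r m0 (inr e).
  pose x1 : K m0 := @Ordinal r.+3 1 isT; pose x2 : K m0 := @Ordinal r.+3 2 isT.
  have x12 : adj x1 x2 by [].
  pose e : {e : K m0 * K m0 | adj e.1 e.2} := exist _ (x1, x2) x12.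
  case pe: (positive (inr e : osimplex (K m0))); first by exists e; apply/and3P.
  exists (exist _ (x2, x1) (rev_arc_subproof e)); apply/and3P; split=> //.
  by have := @positive_rev (K m0) (inr e) isT; rewrite pe.
pose w0 (A : {set 'I_n}) : {ffun 'I_n -> osimplex (K m0)} :=
  [ffun j => if j \in A then inr e0 else inl ord0].
have gw0 A j : good (w0 A j) by rewrite ffunE; case: ifP.
have [M0 hM0] := boolp.choice (fun A =>
  operator_matrix (hmap (unit_map k rm0 rm0 (w0 A) (w0 A)) (p := i)) lv0 bv0 lv0).
exists (fun A => \rank (M0 A)) => m rm.
have [d [[v lv bv]]] := homology_has_dimension k (K m) n i.
suff -> : (\sum_(A : {set 'I_n}) good_edges r m ^ #|A| * \rank (M0 A))%N = d by split; exists v.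
have [M hM] := boolp.choice (fun w =>
  operator_matrix (hmap (unit_map k rm rm w w) (p := i)) lv bv lv).
pose goodw (w : {ffun 'I_n -> osimplex (K m)}) := [forall j, good (w j)].
(* Setting the bad words to zero gives a family indexed by all words. *)
pose N w := if goodw w then M w else 0.
have [vi vK viK] := bv.
have eqM p (A B : 'M[k]_(d, p)) : (forall x : H m, v x *m A = v x *m B) -> A = B.
  move=> h; apply/row_matrixP => j; rewrite !rowE -[delta_mx _ _]viK; exact: h.
have same m' (w : {ffun 'I_n -> osimplex (K m')}) j : same_kind (w j) (w j) by apply: eqxx.
have idM w : goodw w -> M w *m M w = M w.
  move=> /forallP gw; apply: eqM => x; rewrite mulmxA -!hM /=.
  by rewrite unit_map_comp // eqxx.
have dE : d = (\sum_w \rank (N w))%N.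
  apply: orthogonal_idempotents_rank => [|w w' ww'].
    apply: eqM => x; rewrite mulmx1 mulmx_sumr [in RHS](complete_decomposition rm x).
    rewrite /N (bigID goodw) /= [X in _ + X]big1 ?addr0 => [|w /negPf->]; last by rewrite mulmx0.
    pose v' : {linear H m -> 'rV[k]_d} := HB.pack v (GRing.isLinear.Build k _ _ _ v lv).
    rewrite -[RHS]/(v' _) linear_sum; apply: eq_bigr => w gw; rewrite gw -hM //.
  rewrite /N; case: ifP => gw; last by rewrite mul0mx.
  case: ifP => gw'; last by rewrite mulmx0.
  apply: eqM => x; rewrite mulmxA -!hM mulmx0 /=.
  rewrite unit_map_comp ?(negPf ww') //; [|exact/forallP|exact/forallP].
  pose v' : {linear H m -> 'rV[k]_d} := HB.pack v (GRing.isLinear.Build k _ _ _ v lv).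
  by rewrite -[LHS]/(v' 0) linear0.
have rankE w : goodw w -> \rank (M w) = \rank (M0 (edge_factors w)).
  move=> gw; set A := edge_factors w.
  have gw' := forallP gw.
  have ww0 j : same_kind (w j) (w0 A j).
    by rewrite /same_kind ffunE /A inE; case: (is_edge (w j)).
  have w0w j : same_kind (w0 A j) (w j) by rewrite /same_kind eq_sym; apply: ww0.
  (* [B] and [C] pass to the reference word and back. Their two products are the idempotents of [w]
     and of [w0 A], which therefore have equal rank. *)
  have [B hB] := operator_matrix (hmap (unit_map k rm rm0 w (w0 A)) (p := i)) lv bv lv0.
  have [C hC] := operator_matrix (hmap (unit_map k rm0 rm (w0 A) w) (p := i)) lv0 bv0 lv.
  have [vi0 vK0 viK0] := bv0.
  have eqM0 p (X Y : 'M[k]_(d0, p)) : (forall x : H m0, v0 x *m X = v0 x *m Y) -> X = Y.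
    move=> h; apply/row_matrixP => j; rewrite !rowE -[delta_mx _ _]viK0; exact: h.
  have BC : M w = B *m C.
    apply: eqM => x; rewrite mulmxA -hM -hB -hC /=.
    by rewrite unit_map_comp // eqxx.
  have CB : M0 A = C *m B.
    apply: eqM0 => x; rewrite mulmxA -hM0 -hC -hB /=.
    by rewrite unit_map_comp // eqxx.
  rewrite BC CB; apply: rank_idempotent_conj; first by rewrite -BC idM.
  rewrite -CB; apply: eqM0 => x; rewrite mulmxA -!hM0 /=.
  by rewrite unit_map_comp // eqxx.
rewrite dE (bigID goodw) /= [X in _ = (_ + X)%N]big1 ?addn0; last first.
  by move=> w /negPf gw; rewrite /N gw mxrank0.
rewrite (partition_big (@edge_factors r n m) predT) //=; apply: eq_bigr => A _.
rewrite -card_good_words big_distrl /=; apply: eq_bigr => w /andP[gw /eqP <-].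
by rewrite mul1n /N (gw : goodw w) rankE.
Qed.

Lemma complete_dimension_polynomial : exists (p : {poly rat}) (M : nat),
  forall m : nat, (r <= m)%N -> (M <= m)%N ->
    exists d : nat,
      has_dimension (homology k (complete_pgraph m r) n i) d /\ d%:R = p.[m%:R].
Proof.
have [D hD] := complete_dimension.
(* Evaluated at the number [m.+1] of vertices, this is m (m - 1) / 2, the number of good edges. *)
pose q : {poly rat} := 2^-1 *: (('X - 1%:P) * ('X - 2%:P)).
(* The threshold 1 excludes the empty graph, which has no centre for the star. *)
exists (\sum_(A : {set 'I_n}) q ^+ #|A| * (D A)%:R), 1%N => -[//|m] rm _.
exists (\sum_(A : {set 'I_n}) good_edges r m ^ #|A| * D A)%N; split; first exact: hD.
rewrite natr_sum horner_sum; apply: eq_bigr => A _.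
rewrite natrM natrX hornerM horner_exp.
have -> : ((D A)%:R : {poly rat}).[m.+1%:R] = (D A)%:R by rewrite -polyC_natr hornerC.
congr (_ ^+ _ * _); rewrite !hornerE /= -[m.+1%:R]natr1.
have : (good_edges r m)%:R * 2 = m%:R * (m%:R - 1) :> rat.
  rewrite -[2]/(2%:R) -natrM good_edges_double natrM.
  by case: (m) => [|m']; rewrite ?mul0r // -[m'.+1%:R]natr1 addrK.
by move=> h; rewrite -(mulfK (_ : 2 != 0 :> rat) (good_edges r m)%:R) // h; field.
Qed.

End CompletePolynomial.

Local Open Scope classical_set_scope.

Theorem theorem4 (i r n : nat) :
  [/\ exists (l : nat) (P : 'I_l -> pgraph),
        (forall j : 'I_l, cograph (P j) /\ #|pts (P j)| = r) /\
        (forall Q : pgraph, cograph Q -> #|pts Q| = r ->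
           subgroup_generated
             [set y : homology int Q n i |
                exists (j : 'I_l) (f : full_embedding (P j) Q)
                       (x : homology int (P j) n i), y = homology_push f x]
           = [set: homology int Q n i]),
      exists d : nat, (1 <= d)%N /\
        (forall Q : pgraph, cograph Q -> #|pts Q| = r ->
           exponent (@torsion (homology int Q n i)) %| d)%N
    & forall k : fieldType,
        exists (p : {poly rat}) (M : nat),
          forall m : nat, (r <= m)%N -> (M <= m)%N ->
            exists d : nat,
              has_dimension (homology k (complete_pgraph m r) n i) d /\
              (d%:R = p.[m%:R])%R ].
Proof.
split; first exact: homology_generation.
  exact: torsion_exponent_bound.
by move=> k; apply: complete_dimension_polynomial.
Qed.
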